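(* Let $\lambda\ge 0$. In the market model with regime-switching exponential preferences described in the context, the equilibrium trading strategy for problem (P1) is given by $$\hat{\alpha}^{\lambda}_{N-1}= \hat{\alpha}^{0}_{N-1} + H^\lambda ( t_{N-1}, X_{ t_{N-1}},J_{ t_{N-1}}, S_{ t_{N-1}}),$$ with $$ \hat{\alpha}^{0}_{N-1}=\frac{1}{2\gamma(J_{ t_{N-1}})\sigma^1_{ t_{N-1}}\sqrt{h}}\log\bigg(\frac{1+\theta^1_{ t_{N-1}}\sqrt{h}}{1-\theta^1_{ t_{N-1}}\sqrt{h}}\bigg),$$ and $$H^\lambda(t_{N-1},x,i,s)=\frac{1}{h\, \mu^1_{ t_{N-1}} \gamma(i)} \bigg[ \mathbb{E}_{t_{N-1}}\Big[\log\mathbb{E}_{t_{N-1}}^{\mathbb{Q}}\big[e^{\lambda \gamma(i)F(S_T^1,S_T^2)}\big|\mathcal{F}_{t_{N}}^{S^1}\big]\Big]-\mathbb{E}_{t_{N-1}}^{\mathbb{Q}} \Big[\log\mathbb{E}_{t_{N-1}}^{\mathbb{Q}}\big[e^{\lambda\gamma(i)F(S_T^1,S_T^2)}\big|\mathcal{F}_{t_{N}}^{S^1}\big]\Big]\bigg].$$ Moreover, the writer's indifference price at time $t_{N-1}$ is given by $$p^{\lambda}_{t_{N-1}}=G^\lambda ( t_{N-1}, X_{ t_{N-1}},J_{ t_{N-1}}, S_{ t_{N-1}}),$$ where $$G^\lambda(t_{N-1},x,i,s)= \frac{1}{\gamma(i)}\mathbb{E}^{\mathbb{Q}}_{t_{N-1}}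 \bigg[\log\mathbb{E}_{t_{N-1}}^{\mathbb{Q}}\big[e^{\lambda \gamma(i)F(S_T^1,S_T^2)}\big|\mathcal{F}_{t_{N}}^{S^1}\big]\bigg].$$
   Context: Time grid: $T>0$, $N$ a positive integer, $h=T/N$, $t_n=nh$ for $n=0,\dots,N$; $\Delta$ is the forward difference, $\Delta b_{t_n}:=b_{t_{n+1}}-b_{t_n}$. Randomness: on a complete filtered probability space $(\Omega,\mathcal{F},\{\mathcal{F}_{t_n}\},\mathbb{P})$, $(b^1,b^2)$ is a two-dimensional binomial random walk, symmetric in the sense that $\mathbb{P}(\Delta b^i_{t_n}=\pm1)=1/2$, $i=1,2$, and $J$ is a discrete time homogeneous Markov chain with values in $\{\mathbf{0},\mathbf{1}\}$, with $n$-step transition probabilities $P^{(n)}_{ij}=\mathbb{P}(J_{t_n}=j|J_{t_0}=i)$. The distribution of $J_0$ is known and $\mathbb{P}(J_0=i|\mathcal{F}^S_0)=\mathbb{P}(J_0=i)$. The filtration $\{\mathcal{F}_{t_n}\}$ is generated by $(b^1,b^2)$ and $J$. $\{\mathcal{F}^{S}_{t_n}\}$ and $\{\mathcal{F}^{S^1}_{t_n}\}$ are the filtrations generated by the processes $S=(S^1,S^2)$ and $S^1$ below. Assets: the bond is the numeraire (zero interest). The traded stock satisfies $\Delta S_{t_n}^1=S_{t_n}^1(\mu^1_{t_n}h+\sigma^1_{t_n}\sqrt{h}\,\Delta b_{t_n}^1)$, $S^1_0=s^1>0$, with adapted $\mu^1,\sigma^1$ chosen so that $S^1$ remains positive. The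 non-traded asset satisfies $\Delta S_{t_n}^2=S_{t_n}^2(\mu^2_{t_n}h+\sigma^2_{t_n}\sqrt{h}(\rho\Delta b_{t_n}^1+\sqrt{1-\rho^2}\,\Delta b_{t_n}^2))$, $S^2_0=s^2>0$, with adapted $\mu^2,\sigma^2$ and $|\rho|\le1$. The market price of risk is $\theta^1_{t_n}=\mu^1_{t_n}/\sigma^1_{t_n}$, chosen such that $0\le\theta^1_{t_n}\le1/\sqrt{h}$. Wealth: $\alpha_{n}\in\mathcal{F}_{t_n}$ is the wealth invested in stock at $t_n$; $\Delta X^{\alpha}_{t_n}=\alpha_{n}(\mu^1_{t_n} h+\sigma^1_{t_n}\sqrt{h}\,\Delta b_{t_n}^1)$. $\Pi_{t_{N-1}}$ is the set of $\alpha=\alpha_{N-1}\in\mathcal{F}_{t_{N-1}}$ with $\mathbb{E}^{\mathbb{P}}|X^\alpha_{t_{N-1}}|<\infty$. Measure $\mathbb{Q}$: a probability measure under which $(b^1,b^2)$ is a two-dimensional random walk with $\mathbb{Q}(\Delta b^1_{t_n}=1|\mathcal{F}_{t_n})=\frac{1-\theta^1_{t_n}\sqrt h}{2}$, $\mathbb{Q}(\Delta b^1_{t_n}=-1|\mathcal{F}_{t_n})=\frac{1+\theta^1_{t_n}\sqrt h}{2}$, $\mathbb{Q}(\Delta b^2_{t_n}=\pm1|\mathcal{F}_{t_n})=\frac12$, and $\mathbb{Q}(J_{t_n}=j|J_{t_0}=i)=\mathbb{P}(J_{t_n}=j|J_{t_0}=i)=P^{(n)}_{ij}$, for $n=0,\dots,N-1$.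 Notation: $\mathbb{E}_{t_n}[\cdot]=\mathbb{E}^{\mathbb{P}}[\cdot|X_{t_n}=x,J_{t_n}=i,S_{t_n}=s]$ and $\mathbb{E}^{\mathbb{Q}}_{t_n}[\cdot]=\mathbb{E}^{\mathbb{Q}}[\cdot|X_{t_n}=x,J_{t_n}=i,S_{t_n}=s]$; for $\mathcal{G}\subset\mathcal{F}$, $\mathbb{E}^{\mathbb{Q}}_{t_n}[\cdot|\mathcal{G}]$ is the conditional expectation under $\mathbb{Q}$ given $\mathcal{G}\vee\{X_{t_n}=x,S_{t_n}=s,J_{t_n}=i\}$. Preferences and claim: $\gamma(\mathbf 0),\gamma(\mathbf 1)>0$ are the absolute risk aversions in the two regimes. $F$ is a measurable function; the claim pays $F(S^1_T,S^2_T)$ at $T=t_N$, and $\lambda\ge0$ is the number of shares written. Problem (P1): $$V^\lambda_{N-1}(x,i,s)=\sup_{\alpha\in\Pi_{t_{N-1}}}\mathbb{E}_{t_{N-1}}\big[-\exp(-\gamma(i)(X^\alpha_T-\lambda F(S^1_T,S^2_T)))\big];$$ the equilibrium strategy $\hat\alpha^\lambda_{N-1}$ is the maximizer over $\alpha\in\Pi_{t_{N-1}}$ of $\mathbb{E}[-\exp(-\gamma(J_{t_{N-1}})(X^\alpha_T-\lambda F(S^1_T,S^2_T)))|\mathcal{F}_{t_{N-1}}]$. The case $\lambda=0$ gives $\hat\alpha^0_{N-1}$ and $V^0_{N-1}$. Indifference price: $p^\lambda_{t_{N-1}}=G^\lambda(t_{N-1},X_{t_{N-1}},J_{t_{N-1}},S_{t_{N-1}})$,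 where $G^\lambda$ is defined by $V^\lambda_{N-1}(x+G^\lambda(t_{N-1},x,i,s),i,s)=V^0_{N-1}(x,i,s)$.
   Formalization: The strategy part assumes 0<θ¹<1/√h a.s. at t_{N-1} and P absolutely continuous w.r.t. Q on F_{t_N}; E_{t_{N-1}}, V, H and G also condition on an extra F_{t_{N-1}}-variable that with (J,S) fixes the coefficients (trivial if (J,S) does); prices are claimed at states of positive P- and Q-probability. *)

(* Defs.v *)
From HB Require Import structures.
From mathcomp Require Import all_boot all_order all_algebra.
From mathcomp Require Import all_classical all_reals all_analysis.
Import Order.TTheory GRing.Theory Num.Theory.
Import numFieldNormedType.Exports.

Set Implicit Arguments.
Unset Strict Implicit.
Unset Printing Implicit Defensive.

Local Open Scope classical_set_scope.
Local Open Scope ring_scope.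

Section Conditioning.
Context {d : measure_display} {Omega : measurableType d} {R : realType}.
Implicit Types (P : probability Omega R) (G : set (set Omega)).

Definition measurable_wrt G (f : Omega -> R) : Prop :=
  forall B : set R, measurable B -> G (f @^-1` B).

(* [g] is a version of E^P[f | G]. *)
Definition is_cond_exp P G (f g : Omega -> R) : Prop :=
  [/\ P.-integrable setT (EFin \o f), P.-integrable setT (EFin \o g),
      measurable_wrt G g &
      forall A, G A ->
        (\int[P]_(w in A) (g w)%:E = \int[P]_(w in A) (f w)%:E)%E].

(* [p] is a version of P(A | G). *)
Definition is_cond_prob P G (A : set Omega) (p : Omega -> R) : Prop :=
  is_cond_exp P G (\1_A) p.

(* E^P[f | E] for an event [E] of positive probability. *)
Definition exp_given P (E : set Omega) (f : Omega -> R) : \bar R :=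
  (((fine (P E))^-1)%:E * \int[P]_(w in E) (f w)%:E)%E.

Definition prob_given P (A E : set Omega) : R :=
  fine (P (A `&` E)) / fine (P E).

Definition natural_filtration {d' : measure_display} {V : measurableType d'}
    (Y : nat -> Omega -> V) (n : nat) : set (set Omega) :=
  <<s \bigcup_(k in [set k | (k <= n)%N])
        preimage_set_system setT (Y k) measurable >>.

Definition homogeneous_markov_chain P (N : nat) (J : nat -> Omega -> bool)
    : Prop :=
  exists p : bool -> bool -> R,
    (forall i, [/\ 0 <= p i false, 0 <= p i true
                 & p i false + p i true = 1]) /\
    forall (n : nat) (j : nat -> bool), (n < N)%N ->
      P [set w | forall k, (k <= n.+1)%N -> J k w = j k] =
      ((p (j n) (j n.+1))%:E *
         P [set w | forall k, (k <= n)%N -> J k w = j k])%E.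

(* Given the past [Ft n], the increments of [b1] and [b2] are independent
   and +-1-valued; [b1] moves up with probability [p n], [b2] with
   probability 1/2 (e = false is an up move, e = true a down move). *)
Definition binomial_walk P (N : nat) (Ft : nat -> set (set Omega))
    (b1 b2 : nat -> Omega -> R) (p : nat -> Omega -> R) : Prop :=
  forall (n : nat) (e1 e2 : bool), (n < N)%N ->
    is_cond_prob P (Ft n)
      [set w | b1 n.+1 w - b1 n w = (-1) ^+ e1 /\
               b2 n.+1 w - b2 n w = (-1) ^+ e2]
      (fun w => (if e1 then 1 - p n w else p n w) * 2^-1).

End Conditioning.

Record market (R : realType) (Omega : Type) := Market {
  horizon : R;
  steps : nat;
  b1 : nat -> Omega -> R;
  b2 : nat -> Omega -> R;
  J : nat -> Omega -> bool;         (* false is regime 0, true is regime 1 *)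
  rho : R;
  mu1 : nat -> Omega -> R;
  sigma1 : nat -> Omega -> R;
  mu2 : nat -> Omega -> R;
  sigma2 : nat -> Omega -> R;
  S1 : nat -> Omega -> R;
  S2 : nat -> Omega -> R }.

Section Market.
Context {d : measure_display} {Omega : measurableType d} {R : realType}.
Variable M : market R Omega.
Implicit Types (P Q : probability Omega R).

Definition mesh : R := horizon M / (steps M)%:R.

Definition theta (n : nat) (w : Omega) : R := mu1 M n w / sigma1 M n w.

Definition stocks (n : nat) (w : Omega) : R * R := (S1 M n w, S2 M n w).

Definition Ft : nat -> set (set Omega) :=
  natural_filtration (fun n w => (b1 M n w, b2 M n w, J M n w)).

Definition FtS : nat -> set (set Omega) := natural_filtration stocks.

Definition FtS1 : nat -> set (set Omega) := natural_filtration (S1 M).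

Definition stock_return (n : nat) (w : Omega) : R :=
  mu1 M n w * mesh + sigma1 M n w * Num.sqrt mesh * (b1 M n.+1 w - b1 M n w).

Record is_market P : Prop := IsMarket {
  horizon_gt0 : 0 < horizon M;
  steps_gt0 : (0 < steps M)%N;
  b1_measurable :
    forall n, (n <= steps M)%N -> measurable_fun setT (b1 M n);
  b2_measurable :
    forall n, (n <= steps M)%N -> measurable_fun setT (b2 M n);
  J_measurable :
    forall n, (n <= steps M)%N -> measurable_fun setT (J M n);
  b_start : forall w, b1 M 0%N w = 0 /\ b2 M 0%N w = 0;
  b_walk : binomial_walk P (steps M) Ft (b1 M) (b2 M) (fun _ _ => 2^-1);
  J_markov : homogeneous_markov_chain P (steps M) (J M);
  J_start : forall i, is_cond_prob P (FtS 0) [set w | J M 0%N w = i]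
                        (fun _ => fine (P [set w | J M 0%N w = i]));
  rho_le1 : `|rho M| <= 1;
  mu1_adapted : forall n, (n < steps M)%N -> measurable_wrt (Ft n) (mu1 M n);
  sigma1_adapted :
    forall n, (n < steps M)%N -> measurable_wrt (Ft n) (sigma1 M n);
  mu2_adapted : forall n, (n < steps M)%N -> measurable_wrt (Ft n) (mu2 M n);
  sigma2_adapted :
    forall n, (n < steps M)%N -> measurable_wrt (Ft n) (sigma2 M n);
  S1_start : exists2 s1 : R, 0 < s1 & forall w, S1 M 0%N w = s1;
  S2_start : exists2 s2 : R, 0 < s2 & forall w, S2 M 0%N w = s2;
  S1_dynamics : forall n w, (n < steps M)%N ->
    S1 M n.+1 w - S1 M n w = S1 M n w * stock_return n w;
  S1_gt0 : forall n w, (n <= steps M)%N -> 0 < S1 M n w;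
  S2_dynamics : forall n w, (n < steps M)%N ->
    S2 M n.+1 w - S2 M n w =
    S2 M n w * (mu2 M n w * mesh + sigma2 M n w * Num.sqrt mesh *
      (rho M * (b1 M n.+1 w - b1 M n w)
       + Num.sqrt (1 - rho M ^+ 2) * (b2 M n.+1 w - b2 M n w)));
  sigma1_neq0 : forall n w, (n < steps M)%N -> sigma1 M n w != 0;
  theta_bounds : forall n w, (n < steps M)%N ->
    0 <= theta n w <= (Num.sqrt mesh)^-1 }.

Record is_pricing_measure P Q : Prop := IsPricingMeasure {
  Q_walk : binomial_walk Q (steps M) Ft (b1 M) (b2 M)
             (fun n w => (1 - theta n w * Num.sqrt mesh) / 2);
  Q_regime : forall n i j, (n < steps M)%N ->
    (0 < P [set w | J M 0%N w = i])%E -> (0 < Q [set w | J M 0%N w = i])%E ->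
    prob_given Q [set w | J M n w = j] [set w | J M 0%N w = i] =
    prob_given P [set w | J M n w = j] [set w | J M 0%N w = i] }.

(* [a n] is the wealth held in the stock over the n-th period; only the
   periods before the last one are constrained, because the last strategy
   a_(N-1) is the control of the problem. *)
Definition wealth_process (a X : nat -> Omega -> R) : Prop :=
  [/\ measurable_wrt (Ft 0) (X 0%N),
      forall n, (n < (steps M).-1)%N -> measurable_wrt (Ft n) (a n) &
      forall n w, (n < (steps M).-1)%N ->
        X n.+1 w - X n w = a n w * stock_return n w].

Section LastPeriod.
Let N := steps M.
Let h := mesh.
Variables (gamma : bool -> R) (F : R * R -> R) (lam : R).
(* The coefficients are only assumed adapted, so at t_(N-1) they may depend on
   more than (J, S).  [U] records the additional information at t_(N-1) that
   they use: conditioning on the state means fixing (X, J, S, U).  It is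
   trivial (K = unit) for coefficients that are functions of (J, S), and
   can always be taken to be the history of (b1, b2, J) up to t_(N-1). *)
Variables (K : Type) (U : Omega -> K).

Definition state_variable : Prop :=
  (forall u, Ft N.-1 [set w | U w = u]) /\
  forall w w', J M N.-1 w = J M N.-1 w' -> stocks N.-1 w = stocks N.-1 w' ->
    U w = U w' ->
    [/\ mu1 M N.-1 w = mu1 M N.-1 w', sigma1 M N.-1 w = sigma1 M N.-1 w',
        mu2 M N.-1 w = mu2 M N.-1 w' & sigma2 M N.-1 w = sigma2 M N.-1 w'].

(* [W] is the wealth at t_(N-1). *)
Implicit Types (W a : Omega -> R) (x : R) (i : bool) (s : R * R) (u : K).

Definition state_event W x i s u : set Omega :=
  [set w | [/\ W w = x, J M N.-1 w = i, stocks N.-1 w = s & U w = u]].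

Definition admissible P W a : Prop :=
  measurable_wrt (Ft N.-1) a /\ P.-integrable setT (EFin \o W).

Definition terminal_wealth W a (w : Omega) : R :=
  W w + a w * stock_return N.-1 w.

Definition utility (g : R) W a (w : Omega) : R :=
  - expR (- g * (terminal_wealth W a w - lam * F (stocks N w))).

Definition is_equilibrium P W a : Prop :=
  admissible P W a /\
  exists2 va, is_cond_exp P (Ft N.-1)
                (fun w => utility (gamma (J M N.-1 w)) W a w) va &
    forall b vb, admissible P W b ->
      is_cond_exp P (Ft N.-1)
        (fun w => utility (gamma (J M N.-1 w)) W b w) vb ->
      {ae P, forall w, vb w <= va w}.

(* V^lam_(N-1)(x, i, s) is needed for every real x, not just for the wealth
   levels reached by one given process: x is the initial datum of problem
   (P1), i.e. the wealth at t_(N-1) is set to x. *)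
Definition value P x i s u : \bar R :=
  ereal_sup [set exp_given P (state_event (cst x) x i s u)
                   (utility (gamma i) (cst x) a) | a in admissible P (cst x)].

(* E^Q_(t_(N-1))[ . | F^{S^1}_(t_N)] is taken with respect to this
   sigma-algebra. *)
Definition FtS1_with (E : set Omega) : set (set Omega) :=
  <<s FtS1 N `|` [set E] >>.

(* [Y x i s u] is a version of
   E^Q_(t_(N-1))[e^(lam gamma(i) F(S_T)) | F^{S^1}_(t_N)]. *)
Definition is_claim_cond_exp Q W (Y : R -> bool -> R * R -> K -> Omega -> R)
    : Prop :=
  forall x i s u, (0 < Q (state_event W x i s u))%E ->
    is_cond_exp Q (FtS1_with (state_event W x i s u))
      (fun w => expR (lam * gamma i * F (stocks N w))) (Y x i s u).

Variable Y : R -> bool -> R * R -> K -> Omega -> R.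

Definition Hfun P Q W x i s u (w : Omega) : R :=
  (h * mu1 M N.-1 w * gamma i)^-1 *
  (fine (exp_given P (state_event W x i s u) (fun v => ln (Y x i s u v)))
   - fine (exp_given Q (state_event W x i s u) (fun v => ln (Y x i s u v)))).

Definition Gfun Q W x i s u : R :=
  (gamma i)^-1 *
  fine (exp_given Q (state_event W x i s u) (fun v => ln (Y x i s u v))).

Definition alpha0 (w : Omega) : R :=
  (2 * gamma (J M N.-1 w) * sigma1 M N.-1 w * Num.sqrt h)^-1 *
  ln ((1 + theta N.-1 w * Num.sqrt h) / (1 - theta N.-1 w * Num.sqrt h)).

End LastPeriod.

Definition is_indifference_price P (gamma : bool -> R) (F : R * R -> R)
    (lam : R) (K : Type) (U : Omega -> K) x i s u (g : R) : Prop :=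
  value gamma F lam U P (x + g) i s u = value gamma F 0 U P x i s u.

End Market.

(* Main.v *)
(** Up to a null set the history of (b1, b2, J) takes finitely many values, so
    the sigma-algebras F_(t_n) are finite modulo null sets and every statement
    can be checked on their atoms. On an atom of F_(t_(N-1)), averaging the
    utility over the four outcomes of the last increments gives
    - exp (- gamma x + L) * c (A - D), where A is the rescaled position,
    c A = (exp (- A (1 + t)) + exp (A (1 - t))) / 2 with t = theta sqrt h does
    not involve the claim, L is the Q-mean of the conditional log-moment of the
    claim, and D is half its spread between the up and the down move of S1. The
    claim therefore only shifts the optimal position by D, which is H, and
    multiplies the value by exp L, which gives the price L / gamma; the minimum
    of c itself comes from 1 + z <= exp z. *)

Require Import Defs.
From HB Require Import structures.
From mathcomp Require Import all_boot all_order all_algebra.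
From mathcomp Require Import all_classical all_reals all_analysis.
From mathcomp Require Import measurable_realfun ring lra.
Import Order.TTheory GRing.Theory Num.Theory.
Import numFieldNormedType.Exports.
Local Open Scope classical_set_scope.
Local Open Scope ring_scope.

Set Implicit Arguments.
Unset Strict Implicit.
Unset Printing Implicit Defensive.

(** * Sigma-algebras that are finite up to null sets *)

Section SubSigma.
Context {d : measure_display} {Omega : measurableType d} {R : realType}.
Implicit Types (GG G : set (set Omega)) (P : probability Omega R).

(** The price is found without a minimiser: translating strategies by the hedge is a bijection of
    the admissible set, so the value with the claim is a positive multiple of the value without it,
    and the crude bound 1/2 on the cost keeps the latter finite and nonzero. A strict minimum enters
    only for the equilibrium strategy. The main obstacle is [Y]: it is an arbitrary version of a
    conditional expectation given the whole path of S1 and a state event, hence fixed only up to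
    [Q]-null sets, whereas L and D need explicit values. As S1 is positive and sigma1 nonzero, the
    final price reveals the last move of b1; once that price is fixed, the conditioning
    sigma-algebra carries nothing beyond F_(t_(N-1)), so [Y] must be the average of the claim
    exponential over the last move of b2. The [P]-mean in H then requires this identification under
    [P] as well, which is where absolute continuity of [P] with respect to [Q] on F_(t_N) enters. *)

Lemma measurable_wrtP GG (f : Omega -> R) :
  measurable_wrt <<s GG >> f <->
  measurable_fun setT (f : g_sigma_algebraType GG -> R).
Proof.
split=> [mf _ B mB|mf B mB]; first by rewrite setTI; exact: mf.
by have := mf measurableT B mB; rewrite setTI.
Qed.

Lemma measurable_wrt_sub G G' (f : Omega -> R) : G `<=` G' ->
  measurable_wrt G f -> measurable_wrt G' f.
Proof. by move=> GG' mf B mB; apply: GG'; exact: mf. Qed.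

Lemma measurable_wrt_measurable G (f : Omega -> R) : G `<=` measurable ->
  measurable_wrt G f -> measurable_fun setT f.
Proof. by move=> Gm mf _ B mB; rewrite setTI; apply: Gm; exact: mf. Qed.

(** Indivisibility is stated pointwise, so an empty or null member of [G] also qualifies; proofs
    over an indexed family treat empty atoms separately. *)
Definition atom G (A : set Omega) : Prop :=
  G A /\ forall B w w', G B -> A w -> A w' -> B w -> B w'.

Lemma atom_const G A (f : Omega -> R) w w' : measurable_wrt G f ->
  atom G A -> A w -> A w' -> f w' = f w.
Proof.
move=> mf [_ atA] Aw Aw'.
by apply: (atA (f @^-1` [set f w]) w) => //; apply: mf; exact: measurable_set1.
Qed.

End SubSigma.

Section AtomicSigma.
Context {d : measure_display} {Omega : measurableType d} {R : realType}.
Variables (GG : set (set Omega)) (T : finType) (A : T -> set Omega).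
Let G : set (set Omega) := <<s GG >>.
Let D := \bigcup_t A t.
Hypothesis Gm : G `<=` measurable.
Hypothesis atA : forall t, atom G (A t).

Lemma atoms_cover_measurable : G D.
Proof.
suff : measurable (D : set (g_sigma_algebraType GG)) by [].
by apply: fin_bigcup_measurable => [|t _]; [exact: finite_finset|exact: (atA t).1].
Qed.

(** The preimage is a finite union of atoms, joined with the complement of the cover when 0 lies in
    [B]. Conditional expectations and the equilibrium strategy are built this way. *)
Lemma const_on_atoms_measurable_wrt (f : Omega -> R) :
  (forall t w w', A t w -> A t w' -> f w = f w') ->
  measurable_wrt G (fun w => if w \in D then f w else 0).
Proof.
move=> fA B mB.
have -> : (fun w => if w \in D then f w else 0) @^-1` B =
  (\bigcup_(t in [set t | A t `<=` f @^-1` B]) A t) `|`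
  (~` D `&` (cst 0 : Omega -> R) @^-1` B).
  apply/seteqP; split=> w /=.
    case: ifPn => [/set_mem [t _ Atw] Bw|/negP wD B0].
      by left; exists t => // w' Atw' /=; rewrite -(fA t w w').
    by right; split=> // Dw; apply: wD; exact: mem_set.
  case=> [[t /= AtB Atw]|[nDw B0]].
    by rewrite mem_set; [exact: AtB|exists t].
  by rewrite memNset.
suff : measurable ((\bigcup_(t in [set t | A t `<=` f @^-1` B]) A t) `|`
  (~` D `&` (cst 0 : g_sigma_algebraType GG -> R) @^-1` B) :
  set (g_sigma_algebraType GG)) by [].
apply: measurableU.
  by apply: fin_bigcup_measurable => [|t _]; [exact: finite_finset|exact: (atA t).1].
apply: measurableI; first by apply: measurableC; exact: atoms_cover_measurable.
by rewrite -[X in measurable X]setTI; exact: measurable_cst.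
Qed.

Variable P : probability Omega R.
Hypothesis PD : P (~` D) = 0%E.

(** One value per atom and finitely many atoms make a measurable function bounded off a null set.
    Integrability of every utility below comes from here. *)
Lemma atomic_integrable (f : Omega -> R) : measurable_wrt G f ->
  P.-integrable setT (EFin \o f).
Proof.
move=> mf.
have mf' := measurable_wrt_measurable Gm mf.
have mD : measurable D := Gm atoms_cover_measurable.
apply/(negligible_integrable (measurableC mD)) => //.
  exact/measurable_EFinP.
rewrite setTD setCK.
apply: measurable_bounded_integrable => //.
- by rewrite (le_lt_trans (probability_le1 P mD))// ltry.
- exact: measurable_funS mf'.
(* [point] is reached only for an empty atom, where it adds a harmless term to the bound. *)
pose v t := f (xget point (A t)).
exists (\sum_t `|v t|); split; first exact: num_real.
move=> C leC w [t _ Atw] /=.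
have -> : f w = v t.
  by apply: (atom_const mf (atA t)) => //; apply: xgetPex; exists w.
by rewrite (le_trans _ (ltW leC))// (bigD1 t)//= lerDl sumr_ge0.
Qed.

(** An atom meeting a member of [G] lies inside it, so only atoms contained in [B] matter. Two
    indices may name the same atom, so the integral is not expanded over [T]: atoms are peeled off
    the remaining set one at a time. *)
Lemma atoms_le_integral (f g : Omega -> R) B : G B ->
  P.-integrable setT (EFin \o f) -> P.-integrable setT (EFin \o g) ->
  (forall t, A t `<=` B ->
    (\int[P]_(w in A t) (f w)%:E <= \int[P]_(w in A t) (g w)%:E)%E) ->
  (\int[P]_(w in B) (f w)%:E <= \int[P]_(w in B) (g w)%:E)%E.
Proof.
move=> GB fi gi fg.
have mf : measurable_fun setT (EFin \o f) by exact: measurable_int fi.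
have mg : measurable_fun setT (EFin \o g) by exact: measurable_int gi.
have split_int (h : Omega -> R) C E : G C -> G E ->
    measurable_fun setT (EFin \o h) ->
    (\int[P]_(w in E) (h w)%:E = \int[P]_(w in E `&` C) (h w)%:E
       + \int[P]_(w in E `\` C) (h w)%:E)%E.
  move=> /Gm mC /Gm mE mh.
  rewrite -integral_setU ?setUIDK//.
  - exact: measurableI.
  - exact: measurableD.
  - exact: measurable_funS mh.
  - by apply/disj_setPS => w /= [[_ ?] []].
have main : forall (s : seq T) C, G C -> C `<=` B ->
    (forall w, C w -> exists2 t, t \in s & A t w) ->
    (\int[P]_(w in C) (f w)%:E <= \int[P]_(w in C) (g w)%:E)%E.
  elim=> [C _ _ sC|t s IH C GC CB sC].
    suff -> : C = set0 by rewrite !integral_set0.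
    by apply/seteqP; split=> // w /sC[].
  have GD : G (C `\` A t).
    suff : measurable (C `\` A t : set (g_sigma_algebraType GG)) by [].
    by apply: measurableD => //; exact: (atA t).1.
  have le_rest : (\int[P]_(w in C `\` A t) (f w)%:E <=
                  \int[P]_(w in C `\` A t) (g w)%:E)%E.
    apply: IH => // [w [/CB]//|w [Cw nAw]]; have [t' + At'w] := sC _ Cw.
    by rewrite inE => /orP[/eqP tE|t's]; [rewrite tE in At'w|exists t'].
  have [AC|AC] := pselect (exists2 w, A t w & C w).
    have [w Aw Cw] := AC.
    have sAC : C `&` A t = A t.
      apply/seteqP; split=> [w' []//|w' Aw']; split=> //.
      exact: (atA t).2 Aw Aw' Cw.
    have GA : G (A t) := (atA t).1.
    by rewrite !(split_int _ (A t) C)// sAC leeD// fg// -sAC => w' [/CB].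
  suff -> : C = C `\` A t by [].
  by apply/seteqP; split=> [w Cw|w []//]; split=> // Aw; apply: AC; exists w.
have GD := atoms_cover_measurable.
rewrite !(split_int _ D B)//.
have nul (h : Omega -> R) : measurable_fun setT (EFin \o h) ->
    (\int[P]_(w in B `\` D) (h w)%:E = 0)%E.
  move=> mh; apply: null_set_integral.
  - by apply: measurableD; apply: Gm.
  - exact: measurable_funS mh.
  - apply: (subset_measure0 _ _ _ PD); [by apply: measurableD; apply: Gm| |].
      by apply: measurableC; exact: Gm.
    by move=> w [].
rewrite !nul// !adde0; apply: (main (enum T)) => [|w []//|].
  suff : measurable (B `&` D : set (g_sigma_algebraType GG)) by [].
  exact: measurableI.
by move=> w [_ [t _ Atw]]; exists t => //; rewrite mem_enum.
Qed.

Lemma atoms_eq_integral (f g : Omega -> R) B : G B ->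
  P.-integrable setT (EFin \o f) -> P.-integrable setT (EFin \o g) ->
  (forall t, A t `<=` B ->
    (\int[P]_(w in A t) (f w)%:E = \int[P]_(w in A t) (g w)%:E)%E) ->
  (\int[P]_(w in B) (f w)%:E = \int[P]_(w in B) (g w)%:E)%E.
Proof.
move=> GB fi gi fg; apply/eqP; rewrite eq_le.
by apply/andP; split; apply: atoms_le_integral => // t /fg ->.
Qed.

(* The atoms of probability zero form a null set, since there are finitely
   many of them. *)
Lemma ae_atoms (S : Omega -> Prop) :
  (forall t w, A t w -> (0 < P (A t))%E -> S w) -> {ae P, forall w, S w}.
Proof.
move=> HS.
have mA t : measurable (A t) by apply: Gm; exact: (atA t).1.
have null (s : seq T) :
    P.-negligible [set w | exists t, [/\ t \in s, P (A t) = 0%E & A t w]].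
  elim: s => [|t s IH].
    apply: (@negligibleS _ _ _ P set0); last exact: negligible_set0.
    by move=> w [t []].
  have [PA|PA] := eqVneq (P (A t)) 0%E.
    apply: (@negligibleS _ _ _ P (A t `|` _) _ _
              (negligibleU _ IH)); last exact/negligibleP.
    move=> w [t' []]; rewrite inE => /orP[/eqP->|ts PA' Aw]; first by left.
    by right; exists t'.
  apply: negligibleS IH => w [t' []]; rewrite inE => /orP[/eqP->|ts PA' Aw].
    by move=> PA'; rewrite PA' eqxx in PA.
  by exists t'.
have nD : P.-negligible (~` D).
  apply/negligibleP => //; apply: measurableC; apply: Gm.
  exact: atoms_cover_measurable.
apply: negligibleS (negligibleU nD (null (enum T))) => w /= nS.
have [[t _ Atw]|] := pselect (D w); last by left.
right; exists t; split=> //; first exact: mem_enum.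
apply/eqP; rewrite eq_le measure_ge0 andbT leNgt.
by apply/negP => PA; apply: nS; exact: HS Atw PA.
Qed.

End AtomicSigma.

(** * Integration over one binomial step *)

Lemma sum_bool2 (V : nmodType) (f : bool * bool -> V) :
  \sum_e f e = (f (true, true) + f (true, false)) +
               (f (false, true) + f (false, false)).
Proof.
rewrite (eq_bigr (fun e => f (e.1, e.2))) => [|[]//].
by rewrite -(pair_bigA _ (fun i j => f (i, j))) /= !big_bool.
Qed.

Section BinomialStep.
Context {d : measure_display} {Omega : measurableType d} {R : realType}.
Variables (P : probability Omega R) (G : set (set Omega)).
Variables (I : bool * bool -> set Omega) (p : Omega -> R).
Hypothesis Gm : G `<=` measurable.
Hypothesis mI : forall e, measurable (I e).
Hypothesis disjI : forall e e' w, I e w -> I e' w -> e = e'.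
Hypothesis condI : forall e,
  is_cond_prob P G (I e) (fun w => (if e.1 then 1 - p w else p w) * 2^-1).

Lemma indic_comb_at (c : bool * bool -> R) e w : I e w ->
  \sum_e' c e' * \1_(I e') w = c e.
Proof.
move=> Iw; rewrite (bigD1 e)//= big1 ?addr0 => [|e' e'e].
  by rewrite indicE mem_set// mulr1.
rewrite indicE memNset ?mulr0// => Iw'.
by rewrite (disjI Iw Iw') eqxx in e'e.
Qed.

Lemma integral_indic_comb A (c : bool * bool -> R) : measurable A ->
  (\int[P]_(w in A) (\sum_e c e * \1_(I e) w)%:E =
   (\sum_e c e * fine (P (A `&` I e)))%:E)%E.
Proof.
move=> mA.
have iI e : P.-integrable A (fun w => (\1_(I e) w)%:E).
  by apply: (integrableS measurableT) => //; exact: integrable_indic.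
under eq_integral do rewrite -sumEFin.
rewrite integral_sum//; last first.
  move=> e; under eq_fun do rewrite EFinM.
  exact: integrableZl.
rewrite -sumEFin; apply: eq_bigr => e _.
under eq_integral do rewrite EFinM.
rewrite integralZl// integral_indic// setIC EFinM fineK//.
by apply: fin_num_measure; exact: measurableI.
Qed.

Variables (A : set Omega) (q : R).
Hypothesis GA : G A.
Hypothesis pA : forall w, A w -> p w = q.

(** [A] itself serves as test event for the conditional probability, whose version is constant
    there. *)
Lemma step_prob e :
  fine (P (A `&` I e)) = (if e.1 then 1 - q else q) / 2 * fine (P A).
Proof.
have [_ _ _ /(_ A GA)] := condI e.
rewrite integral_indic//; last exact: Gm.
rewrite setIC => <-.
have -> : (\int[P]_(w in A) ((if e.1 then 1 - p w else p w) * 2^-1)%:E)%E =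
   (\int[P]_(w in A) (cst ((if e.1 then 1 - q else q) / 2)%:E) w)%E.
  by apply: eq_integral => w /set_mem Aw; rewrite pA.
by rewrite integral_cst ?fineM//; [exact: fin_num_measure (Gm GA)|exact: Gm].
Qed.

(** The four conditional probabilities add up to one, which leaves no mass on [A] for any other
    outcome. *)
Lemma ae_step : {ae P, forall w, A w -> exists e, I e w}.
Proof.
have mA := Gm GA.
have mU : measurable (\bigcup_e I e).
  by apply: fin_bigcup_measurable => [|e _]; [exact: finite_finset|].
exists (A `\` \bigcup_e I e); split; first exact: measurableD.
  have: fine (P (A `&` \bigcup_e I e)) = fine (P A).
    rewrite setIC -integral_indic//.
    transitivity (fine (\int[P]_(w in A) (\sum_e 1 * \1_(I e) w)%:E)%E).
      congr fine; apply: eq_integral => w _; congr EFin; rewrite indicE.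
      have [[e _ Iew]|nI] := pselect ((\bigcup_e I e) w).
        by rewrite mem_set ?(indic_comb_at _ Iew)//; exists e.
      rewrite memNset// big1// => e _; rewrite indicE memNset ?mulr0// => Iew.
      by apply: nI; exists e.
    rewrite integral_indic_comb//=.
    by rewrite sum_bool2 !step_prob/=; lra.
  have := @measureDI _ _ _ P A _ mA mU.
  have f1 : P (A `\` \bigcup_e I e) \is a fin_num.
    by apply: fin_num_measure; exact: measurableD.
  have f2 : P (A `&` \bigcup_e I e) \is a fin_num.
    by apply: fin_num_measure; exact: measurableI.
  rewrite -(fineK f1) -(fineK f2) => ->.
  by rewrite fineD// => H; congr EFin; rewrite /= in H *; lra.
move=> w /= /not_implyP[Aw nI]; split=> // -[e _ Ie].
by apply: nI; exists e.
Qed.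

(** Agreement with [c] is asked only almost everywhere, so that versions of conditional expectations
    can be integrated; [A] may be any event of [G] on which [p] is constant, such as a state
    event. *)
Lemma integral_step (f : Omega -> R) (c : bool * bool -> R) :
  measurable_fun setT f ->
  {ae P, forall w, A w -> forall e, I e w -> f w = c e} ->
  (\int[P]_(w in A) (f w)%:E =
   (fine (P A) * (q * (c (false, false) + c (false, true)) / 2
     + (1 - q) * (c (true, false) + c (true, true)) / 2))%:E)%E.
Proof.
move=> mf fc.
have mA := Gm GA.
transitivity (\int[P]_(w in A) (\sum_e c e * \1_(I e) w)%:E)%E.
  apply: ae_eq_integral => //.
  - by apply/measurable_EFinP; exact: measurable_funS mf.
  - apply/measurable_EFinP; apply: measurable_sum => e.
    by apply: measurable_funM => //; exact: measurable_indic.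
  - apply: filterS2 fc ae_step => w fcw /[swap] Aw /(_ Aw)[e Ie].
    by rewrite (indic_comb_at _ Ie) (fcw Aw e).
rewrite integral_indic_comb//; congr EFin.
by rewrite sum_bool2 !step_prob/=; lra.
Qed.

End BinomialStep.

(** * The filtration of the market *)

Section Filtration.
Context {d : measure_display} {Omega : measurableType d} {R : realType}.

Lemma natural_filtration_preimage {d'} {V : measurableType d'}
    (Z : nat -> Omega -> V) n k B : (k <= n)%N -> measurable B ->
  natural_filtration Z n (Z k @^-1` B).
Proof.
move=> kn mB; apply: sub_sigma_algebra; exists k => //.
by exists B => //; rewrite setTI.
Qed.

Lemma natural_filtration_sub {d'} {V : measurableType d'}
    (Z : nat -> Omega -> V) n (G : set (set Omega)) :
  sigma_algebra setT G ->
  (forall k B, (k <= n)%N -> measurable B -> G (Z k @^-1` B)) ->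
  natural_filtration Z n `<=` G.
Proof.
move=> sG ZG; apply: smallest_sub => // _ [k /= kn [B mB <-]].
by rewrite setTI; exact: ZG.
Qed.

Lemma natural_filtration_mono {d'} {V : measurableType d'}
    (Z : nat -> Omega -> V) m n : (m <= n)%N ->
  natural_filtration Z m `<=` natural_filtration Z n.
Proof.
move=> mn; apply: natural_filtration_sub; first exact: smallest_sigma_algebra.
move=> k B km mB; apply: natural_filtration_preimage => //.
exact: leq_trans km mn.
Qed.

(** Reduces indivisibility of [A] to the generators of a sigma-algebra. *)
Lemma indivisible_sigma_algebra (A : set Omega) : sigma_algebra setT
  [set B : set Omega | forall w w', A w -> A w' -> B w -> B w'].
Proof.
split=> [w w' _ _ []|B IB w w' Aw Aw' [_ nB]|B IB w w' Aw Aw' [k _ Bk]].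
  by split=> // Bw'; apply: nB; exact: IB Aw' Aw Bw'.
by exists k => //; exact: IB Bk.
Qed.

Implicit Types GG : set (set Omega).

Lemma measurable_wrt_cst GG (r : R) : measurable_wrt <<s GG >> (cst r : Omega -> R).
Proof. by apply/measurable_wrtP; exact: measurable_cst. Qed.

Lemma measurable_wrtD GG (f g : Omega -> R) : measurable_wrt <<s GG >> f ->
  measurable_wrt <<s GG >> g -> measurable_wrt <<s GG >> (fun w => f w + g w).
Proof.
move=> /measurable_wrtP mf /measurable_wrtP mg; apply/measurable_wrtP.
exact: measurable_funD.
Qed.

Lemma measurable_wrtM GG (f g : Omega -> R) : measurable_wrt <<s GG >> f ->
  measurable_wrt <<s GG >> g -> measurable_wrt <<s GG >> (fun w => f w * g w).
Proof.
move=> /measurable_wrtP mf /measurable_wrtP mg; apply/measurable_wrtP.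
exact: measurable_funM.
Qed.

Lemma measurable_wrtB GG (f g : Omega -> R) : measurable_wrt <<s GG >> f ->
  measurable_wrt <<s GG >> g -> measurable_wrt <<s GG >> (fun w => f w - g w).
Proof.
move=> /measurable_wrtP mf /measurable_wrtP mg; apply/measurable_wrtP.
exact: measurable_funB.
Qed.

Lemma measurable_wrt_comp2 GG (f g : Omega -> R) (F : R * R -> R) :
  measurable_fun setT F ->
  measurable_wrt <<s GG >> f -> measurable_wrt <<s GG >> g ->
  measurable_wrt <<s GG >> (fun w => F (f w, g w)).
Proof.
move=> mF /measurable_wrtP mf /measurable_wrtP mg; apply/measurable_wrtP.
by apply: (measurableT_comp mF); exact: measurable_fun_pair.
Qed.

Lemma measurable_wrt_comp GG (f : Omega -> R) (F : R -> R) :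
  measurable_fun setT F ->
  measurable_wrt <<s GG >> f -> measurable_wrt <<s GG >> (fun w => F (f w)).
Proof.
move=> mF /measurable_wrtP mf; apply/measurable_wrtP.
exact: (measurableT_comp mF).
Qed.

Lemma sigmaI GG A B : <<s GG >> A -> <<s GG >> B -> <<s GG >> (A `&` B).
Proof.
move=> GA GB.
by have := @measurableI _ (g_sigma_algebraType GG) A B GA GB.
Qed.

End Filtration.

Section MarketFiltration.
Context {d : measure_display} {Omega : measurableType d} {R : realType}.
Variables (P : probability Omega R) (M : market R Omega).
Hypothesis HM : is_market M P.
Let N := steps M.

Definition increments n (e : bool * bool) : set Omega :=
  [set w | b1 M n.+1 w - b1 M n w = (-1) ^+ e.1 /\
           b2 M n.+1 w - b2 M n w = (-1) ^+ e.2].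

Lemma increments_disjoint n e e' w :
  increments n e w -> increments n e' w -> e = e'.
Proof.
move=> [h1 h2] [h1' h2']; rewrite h1 in h1'; rewrite h2 in h2'.
by case: e e' h1 h2 h1' h2' => [? ?] [? ?] /= _ _ /signr_inj -> /signr_inj ->.
Qed.

Lemma Ft_measurable n : (n <= N)%N -> Ft M n `<=` measurable.
Proof.
move=> nN; apply: natural_filtration_sub; first exact: sigma_algebra_measurable.
move=> k B kn mB; have kN := leq_trans kn nN.
suff mY : measurable_fun setT (fun w => (b1 M k w, b2 M k w, J M k w)).
  by have := mY measurableT B mB; rewrite setTI.
apply: measurable_fun_pair; last exact: (J_measurable HM).
by apply: measurable_fun_pair; [exact: (b1_measurable HM)|exact: (b2_measurable HM)].
Qed.

Lemma Ft_mono m n : (m <= n)%N -> Ft M m `<=` Ft M n.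
Proof. exact: natural_filtration_mono. Qed.

Lemma b1_adapted n k : (k <= n)%N -> measurable_wrt (Ft M n) (b1 M k).
Proof.
move=> kn B mB.
rewrite (_ : _ @^-1` _ = (fun w => (b1 M k w, b2 M k w, J M k w)) @^-1`
    ((fst \o fst : R * R * bool -> R) @^-1` B))//.
apply: natural_filtration_preimage => //.
rewrite -[X in measurable X]setTI; apply: measurableT_comp => //.
Qed.

Lemma b2_adapted n k : (k <= n)%N -> measurable_wrt (Ft M n) (b2 M k).
Proof.
move=> kn B mB.
rewrite (_ : _ @^-1` _ = (fun w => (b1 M k w, b2 M k w, J M k w)) @^-1`
    ((snd \o fst : R * R * bool -> R) @^-1` B))//.
apply: natural_filtration_preimage => //.
rewrite -[X in measurable X]setTI; apply: measurableT_comp => //.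
Qed.

Lemma J_adapted n k i : (k <= n)%N -> Ft M n [set w | J M k w = i].
Proof.
move=> kn.
rewrite (_ : mkset _ = (fun w => (b1 M k w, b2 M k w, J M k w)) @^-1`
    ((snd : R * R * bool -> bool) @^-1` [set i]))//.
apply: natural_filtration_preimage => //.
by rewrite -[X in measurable X]setTI; exact: measurable_snd.
Qed.

Lemma increments_adapted n e : Ft M n.+1 (increments n e).
Proof.
have db (b : nat -> Omega -> R) (s : R) :
    (forall k, (k <= n.+1)%N -> measurable_wrt (Ft M n.+1) (b k)) ->
    Ft M n.+1 [set w | b n.+1 w - b n w = s].
  move=> mb; have /(_ [set s] (measurable_set1 _)) := measurable_wrtB (mb _ (leqnn _)) (mb _ (leqnSn _)).
  by [].
by apply: sigmaI; apply: db => k; [exact: b1_adapted|exact: b2_adapted].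
Qed.

(** Half of [p n] is itself a version of a conditional probability given F_(t_n), hence measurable
    for it. *)
Lemma walk_prob_adapted Q p n : binomial_walk Q N (Ft M) (b1 M) (b2 M) p ->
  (n < N)%N -> measurable_wrt (Ft M n) (p n).
Proof.
move=> HQ nN; have [_ _ mp _] := HQ n false false nN.
rewrite (_ : p n = fun w => p n w * 2^-1 * 2); last first.
  by apply/funext => w; rewrite mulfVK.
by apply: measurable_wrtM mp _; exact: measurable_wrt_cst.
Qed.

(** At time 0 the walks start at 0 everywhere, so the atoms are the two regimes; each step splits an
    atom by the four increments and the next regime. The family is chosen before the measure, hence
    is common to all binomial walk measures. *)
Lemma Ft_atomic n : (n <= N)%N -> exists (T : finType) (A : T -> set Omega),
  (forall t, atom (Ft M n) (A t)) /\
  forall Q p, binomial_walk Q N (Ft M) (b1 M) (b2 M) p ->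
    Q (~` \bigcup_t A t) = 0%E.
Proof.
elim: n => [_|n IH nN].
  exists bool, (fun i => [set w | J M 0%N w = i]); split=> [i|Q p _].
    split=> [|B w w' FB Aw Aw' Bw]; first exact: J_adapted.
    move: B FB w w' Aw Aw' Bw; apply: natural_filtration_sub.
      exact: indivisible_sigma_algebra.
    move=> k B; rewrite leqn0 => /eqP-> _ w w' /= -> ->.
    by have [-> ->] := b_start HM w; have [-> ->] := b_start HM w'.
  rewrite (_ : ~` _ = set0) ?measure0//; apply/seteqP; split=> // w /= nJ.
  by apply: nJ; exists (J M 0%N w).
have [T [A [atA nullA]]] := IH (ltnW nN).
exists (T * (bool * bool) * bool)%type,
  (fun t => A t.1.1 `&` increments n t.1.2 `&` [set w | J M n.+1 w = t.2]).
have mA t : Ft M n.+1 (A t.1.1 `&` increments n t.1.2 `&` [set w | J M n.+1 w = t.2]).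
  apply: sigmaI; last exact: J_adapted.
  apply: sigmaI; last exact: increments_adapted.
  by apply: (Ft_mono (leqnSn n)); exact: (atA _).1.
split=> [[[t e] i]|Q p HQ].
  split=> [|B w w' FB Aw Aw' Bw]; first exact: mA.
  move: B FB w w' Aw Aw' Bw; apply: natural_filtration_sub.
    exact: indivisible_sigma_algebra.
  move=> k B kn mB w w' /= [[Aw [e1 e2]] Jw] [[Aw' [e1' e2']] Jw'].
  move: kn; rewrite leq_eqVlt => /orP[/eqP->|kn]; last first.
    apply: ((atA t).2 ((fun v => (b1 M k v, b2 M k v, J M k v)) @^-1` B)
              w w' _ Aw Aw').
    exact: natural_filtration_preimage.
  (* The walks are constant on the old atom, so prescribing the increments fixes their new
     values. *)
  have c1 : b1 M n w' = b1 M n w by apply: atom_const (b1_adapted (leqnn n)) (atA t) Aw Aw'.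
  have c2 : b2 M n w' = b2 M n w by apply: atom_const (b2_adapted (leqnn n)) (atA t) Aw Aw'.
  rewrite /= Jw Jw'; congr (B (_, _, _)).
    by apply: (addIr (- b1 M n w)); rewrite e1 -c1 e1'.
  by apply: (addIr (- b2 M n w)); rewrite e2 -c2 e2'.
have mD : measurable (~` \bigcup_t (A t.1.1 `&` increments n t.1.2 `&` [set w | J M n.+1 w = t.2])).
  apply: measurableC; apply: fin_bigcup_measurable => [|t _].
    exact: finite_finset.
  by apply: (Ft_measurable nN); exact: mA.
apply/negligibleP => //.
(* Increments are signs only almost surely, with an exceptional set depending on the atom;
   finiteness of [T] merges these sets. *)
have aes : {ae Q, forall w, forall t, A t w -> exists e, increments n e w}.
  apply: filter_forall => t.
  have [Aw|nA] := pselect (exists w, A t w); last first.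
    by apply: aeW => w Aw; exfalso; apply: nA; exists w.
  have [w0 Aw0] := Aw.
  apply: (@ae_step _ _ _ Q (Ft M n) (increments n) (p n) _ _ _ _ _ (p n w0)).
  - exact: Ft_measurable (ltnW nN).
  - by move=> e; apply: (Ft_measurable nN); exact: increments_adapted.
  - exact: increments_disjoint.
  - by move=> e; exact: HQ.
  - exact: (atA t).1.
  - move=> w Aw'; apply: atom_const (walk_prob_adapted HQ nN) (atA t) Aw0 Aw'.
have aeA : {ae Q, forall w, (\bigcup_t A t) w}.
  exists (~` \bigcup_t A t); split => //; last exact: nullA HQ.
  apply: measurableC; apply: fin_bigcup_measurable => [|t _].
    exact: finite_finset.
  by apply: (Ft_measurable (ltnW nN)); exact: (atA t).1.
suff : {ae Q, forall w, (\bigcup_t (A t.1.1 `&` increments n t.1.2 `&` [set w | J M n.+1 w = t.2])) w} by [].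
apply: filterS2 aes aeA => w + [t _ At] => /(_ t At)[e Ie].
by exists (t, e, J M n.+1 w).
Qed.

Lemma stock_return_adapted n : (n < N)%N ->
  measurable_wrt (Ft M n.+1) (stock_return M n).
Proof.
move=> nN.
have sub (f : Omega -> R) : measurable_wrt (Ft M n) f -> measurable_wrt (Ft M n.+1) f.
  by apply: measurable_wrt_sub; exact: Ft_mono (leqnSn n).
apply: (@measurable_wrtD _ _ _ _ (fun w => mu1 M n w * mesh M)
  (fun w => sigma1 M n w * Num.sqrt (mesh M) * (b1 M n.+1 w - b1 M n w)));
  apply: measurable_wrtM.
- by apply: sub; exact: (mu1_adapted HM).
- exact: measurable_wrt_cst.
- apply: measurable_wrtM; last exact: measurable_wrt_cst.
  by apply: sub; exact: (sigma1_adapted HM).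
- by apply: measurable_wrtB; exact: b1_adapted.
Qed.

Lemma S1_adapted n : (n <= N)%N -> measurable_wrt (Ft M n) (S1 M n).
Proof.
elim: n => [_|n IH nN].
  have [s1 _ /funext ->] := S1_start HM; exact: measurable_wrt_cst.
have mS : measurable_wrt (Ft M n.+1) (S1 M n).
  apply: measurable_wrt_sub (IH (ltnW nN)); exact: Ft_mono (leqnSn n).
rewrite (_ : S1 M n.+1 = fun w => S1 M n w + S1 M n w * stock_return M n w).
  by apply: measurable_wrtD => //; apply: measurable_wrtM => //; exact: stock_return_adapted.
by apply/funext => w; rewrite -(S1_dynamics HM _ nN) addrC subrK.
Qed.

Lemma S2_adapted n : (n <= N)%N -> measurable_wrt (Ft M n) (S2 M n).
Proof.
elim: n => [_|n IH nN].
  have [s1 _ /funext ->] := S2_start HM; exact: measurable_wrt_cst.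
have sub (f : Omega -> R) : measurable_wrt (Ft M n) f -> measurable_wrt (Ft M n.+1) f.
  by apply: measurable_wrt_sub; exact: Ft_mono (leqnSn n).
have mS := sub _ (IH (ltnW nN)).
rewrite (_ : S2 M n.+1 = fun w => S2 M n w +
  S2 M n w * (mu2 M n w * mesh M + sigma2 M n w * Num.sqrt (mesh M) *
      (rho M * (b1 M n.+1 w - b1 M n w)
       + Num.sqrt (1 - rho M ^+ 2) * (b2 M n.+1 w - b2 M n w)))).
  apply: measurable_wrtD => //; apply: measurable_wrtM => //.
  apply: measurable_wrtD; apply: measurable_wrtM.
  - by apply: sub; exact: (mu2_adapted HM).
  - exact: measurable_wrt_cst.
  - apply: measurable_wrtM; last exact: measurable_wrt_cst.
    by apply: sub; exact: (sigma2_adapted HM).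
  - apply: measurable_wrtD; apply: measurable_wrtM; try exact: measurable_wrt_cst.
      by apply: measurable_wrtB; exact: b1_adapted.
    by apply: measurable_wrtB; exact: b2_adapted.
by apply/funext => w; rewrite -(S2_dynamics HM _ nN) addrC subrK.
Qed.

Lemma wealth_adapted (a X : nat -> Omega -> R) n : wealth_process M a X ->
  (n <= N.-1)%N -> measurable_wrt (Ft M n) (X n).
Proof.
move=> [mX0 ma dX]; elim: n => [//|n IH nN].
have sub (f : Omega -> R) : measurable_wrt (Ft M n) f -> measurable_wrt (Ft M n.+1) f.
  by apply: measurable_wrt_sub; exact: Ft_mono (leqnSn n).
rewrite (_ : X n.+1 = fun w => X n w + a n w * stock_return M n w).
  apply: measurable_wrtD; first by apply: sub; exact: IH (ltnW nN).
  apply: measurable_wrtM; first by apply: sub; exact: ma.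
  by apply: stock_return_adapted; exact: leq_trans nN (leq_pred _).
by apply/funext => w; rewrite -dX// addrC subrK.
Qed.

End MarketFiltration.

(** * The exponential cost function *)

Section ExponentialCost.
Context {R : realType}.
Implicit Types t A y z : R.

Definition expcost t A : R := (expR (- (A * (1 + t))) + expR (A * (1 - t))) / 2.

Lemma expcost0 t : expcost t 0 = 1.
Proof. by rewrite /expcost !mul0r oppr0 expR0; lra. Qed.

(** For either sign of [A] one of the two exponents is nonnegative. The bound is the unattained
    infimum at t = 1. *)
Lemma expcost_ge t A : 0 <= t <= 1 -> 2^-1 <= expcost t A.
Proof.
move=> /andP[t0 t1]; rewrite /expcost.
have e1 := expR_gt0 (- (A * (1 + t))); have e2 := expR_gt0 (A * (1 - t)).
have [A0|A0] := leP 0 A.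
  have : 1 <= expR (A * (1 - t)).
    by rewrite -[leLHS]expR0 ler_expR mulr_ge0// subr_ge0.
  by lra.
have : 1 <= expR (- (A * (1 + t))).
  by rewrite -[leLHS]expR0 ler_expR; nra.
by lra.
Qed.

(* Writing A = argmin + B factors the cost as
   k * ((1 - t) * exp (- B (1 + t)) + (1 + t) * exp (B (1 - t))), and
   1 + z <= exp z bounds the second factor below by its value 2 at B = 0. *)
Lemma expcost_min t A : 0 < t < 1 -> A != ln ((1 + t) / (1 - t)) / 2 ->
  expcost t (ln ((1 + t) / (1 - t)) / 2) < expcost t A.
Proof.
move=> /andP[t0 t1]; set A0 := ln _ / 2 => AA0.
have s0 : 0 < 1 - t by lra.
have r0 : 0 < (1 + t) / (1 - t) by rewrite divr_gt0//; lra.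
pose k := expR (A0 * (1 - t)) / (1 + t) / 2.
have k0 : 0 < k by rewrite !divr_gt0 ?expR_gt0//; lra.
have t10 : 1 + t != 0 by rewrite gt_eqF//; lra.
have E (B : R) : expcost t (A0 + B) =
    k * ((1 - t) * expR (- (B * (1 + t))) + (1 + t) * expR (B * (1 - t))).
  rewrite /expcost /k !mulrDl opprD !expRD.
  (* This ratio of the two exponentials is the first-order condition at [A0]. *)
  suff -> : expR (- (A0 * (1 + t))) = expR (A0 * (1 - t)) * ((1 - t) / (1 + t)).
    by field.
  have -> : - (A0 * (1 + t)) = A0 * (1 - t) + - (A0 * 2) by ring.
  rewrite expRD; congr (_ * _).
  by rewrite expRN /A0 divfK ?lnK ?posrE// ?invf_div// pnatr_eq0.
rewrite -[A in ltRHS](subrKC A0) -{1}[A0]addr0 !E.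
set B := A - A0; have B0 : B != 0 by rewrite subr_eq0.
rewrite ltr_pM2l// !mul0r oppr0 expR0.
have h1 : 1 - B * (1 + t) < expR (- (B * (1 + t))).
  by rewrite expR_gt1Dx// oppr_eq0 mulf_neq0.
have h2 : 1 + B * (1 - t) < expR (B * (1 - t)).
  by rewrite expR_gt1Dx// mulf_neq0// gt_eqF.
(* With the weights 1 - t and 1 + t the linear terms in [B] cancel, leaving the value 2. *)
have h3 : 0 < (1 - t) * (expR (- (B * (1 + t))) - (1 - B * (1 + t))).
  by rewrite mulr_gt0// subr_gt0.
have h4 : 0 < (1 + t) * (expR (B * (1 - t)) - (1 + B * (1 - t))).
  by rewrite mulr_gt0// ?subr_gt0//; lra.
by lra.
Qed.

(** Matching the two exponentials separately gives two linear equations for the log-factor and the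
    shift. The weights (1 - t) / 2 and (1 + t) / 2 that come out are the pricing probabilities of an
    up and a down move. *)
Lemma expcost_tilt t A y z : 0 < y -> 0 < z ->
  (y * expR (- (A * (1 + t))) + z * expR (A * (1 - t))) / 2 =
  expR ((1 - t) / 2 * ln y + (1 + t) / 2 * ln z)
    * expcost t (A - (ln y - ln z) / 2).
Proof.
move=> y0 z0; rewrite /expcost [RHS]mulrA [in RHS]mulrDr -!expRD; congr ((_ + _) / 2).
  rewrite -{1}(lnK (x := y)) ?posrE// -expRD; congr expR; lra.
rewrite -{1}(lnK (x := z)) ?posrE// -expRD; congr expR; lra.
Qed.

End ExponentialCost.

(** * Expected utility over the last period *)

Section LastPeriod.
Context {d : measure_display} {Omega : measurableType d} {R : realType}.
Variables (P : probability Omega R) (M : market R Omega).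
Hypothesis HM : is_market M P.
Variables (F : R * R -> R) (mF : measurable_fun setT F).
Local Notation N := (steps M).
Local Notation n := (steps M).-1.
Local Notation h := (mesh M).

Lemma last_periodS : N = n.+1.
Proof. by rewrite prednK// (steps_gt0 HM). Qed.

Lemma last_period_lt : (n < N)%N.
Proof. by rewrite -last_periodS. Qed.

Lemma mesh_gt0 : 0 < h.
Proof. by rewrite divr_gt0 ?(horizon_gt0 HM)// ltr0n (steps_gt0 HM). Qed.

Lemma Ft_integrable Q p k (f : Omega -> R) :
  binomial_walk Q N (Ft M) (b1 M) (b2 M) p -> (k <= N)%N ->
  measurable_wrt (Ft M k) f -> Q.-integrable setT (EFin \o f).
Proof.
move=> HQ kN mf; have [T [A [atA nullA]]] := Ft_atomic HM kN.
exact: (atomic_integrable (Ft_measurable HM kN) atA (nullA _ _ HQ)).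
Qed.

Lemma regime_adapted (c : bool -> R) k :
  measurable_wrt (Ft M k) (fun w => c (J M k w)).
Proof.
move=> B mB.
rewrite (_ : _ @^-1` _ = (fun w => (b1 M k w, b2 M k w, J M k w)) @^-1`
    ((snd : R * R * bool -> bool) @^-1` (c @^-1` B)))//.
apply: natural_filtration_preimage => //.
by rewrite -[X in measurable X]setTI; exact: measurable_snd.
Qed.

Lemma Ft_wrt_mono (f : Omega -> R) k m : (k <= m)%N ->
  measurable_wrt (Ft M k) f -> measurable_wrt (Ft M m) f.
Proof. by move=> km; apply: measurable_wrt_sub; exact: Ft_mono. Qed.

Lemma stocks_fun_adapted : measurable_wrt (Ft M N) (fun w => F (stocks M N w)).
Proof.
by apply: measurable_wrt_comp2 => //; [exact: S1_adapted HM _ _|exact: S2_adapted HM _ _].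
Qed.

Lemma utility_adapted lam (g W a : Omega -> R) :
  measurable_wrt (Ft M n) g -> measurable_wrt (Ft M n) W ->
  measurable_wrt (Ft M n) a ->
  measurable_wrt (Ft M N) (fun w => utility M F lam (g w) W a w).
Proof.
move=> mg mW ma; have nN := ltnW last_period_lt.
have mr : measurable_wrt (Ft M N) (stock_return M n).
  by rewrite [X in Ft M X]last_periodS; exact: stock_return_adapted HM _ last_period_lt.
apply: (@measurable_wrt_comp _ _ _ _ _ (fun x => - expR x)).
  by apply: measurableT_comp => //; exact: measurable_funN.
apply: measurable_wrtM.
  apply: (@measurable_wrt_comp _ _ _ _ g (fun x => - x)).
    exact: measurable_funN.
  exact: Ft_wrt_mono (leq_pred _) mg.
apply: measurable_wrtB.
  apply: measurable_wrtD; first exact: Ft_wrt_mono (leq_pred _) mW.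
  by apply: measurable_wrtM => //; exact: Ft_wrt_mono (leq_pred _) ma.
by apply: measurable_wrtM; [exact: measurable_wrt_cst|exact: stocks_fun_adapted].
Qed.

(** Everything known at t_(N-1) that governs the last step of the stocks; equality of these tuples
    is the key by which quantities at two outcomes are identified. *)
Definition coefficients (w : Omega) :=
  (S1 M n w, S2 M n w, mu1 M n w, sigma1 M n w, mu2 M n w, sigma2 M n w).

Definition volatility (w : Omega) : R := sigma1 M n w * Num.sqrt h.

Definition tilt (w : Omega) : R := theta M n w * Num.sqrt h.

Definition next_stocks (w : Omega) (e : bool * bool) : R * R :=
  (S1 M n w * (1 + (mu1 M n w * h + volatility w * (-1) ^+ e.1)),
   S2 M n w * (1 + (mu2 M n w * h + sigma2 M n w * Num.sqrt h *
     (rho M * (-1) ^+ e.1 + Num.sqrt (1 - rho M ^+ 2) * (-1) ^+ e.2)))).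

(** The explicit inner conditional expectation after the last b1 move [e1]: only the b2 move is
    averaged, and it is fair under [P] and [Q] alike. *)
Definition claim_mgf c (w : Omega) (e1 : bool) : R :=
  (expR (c * F (next_stocks w (e1, false)))
   + expR (c * F (next_stocks w (e1, true)))) / 2.

Definition log_mean c (w : Omega) : R :=
  (1 - tilt w) / 2 * ln (claim_mgf c w false)
  + (1 + tilt w) / 2 * ln (claim_mgf c w true).

Definition log_gap c (w : Omega) : R :=
  (ln (claim_mgf c w false) - ln (claim_mgf c w true)) / 2.

Definition cost lam g (w : Omega) x a : R :=
  expR (- g * x + log_mean (lam * g) w)
  * expcost (tilt w) (g * a * volatility w - log_gap (lam * g) w).

Lemma next_stocks_ext w w' e : coefficients w = coefficients w' ->
  next_stocks w e = next_stocks w' e.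
Proof. by rewrite /next_stocks /volatility => -[-> -> -> -> -> ->]. Qed.

Lemma claim_mgf_ext c w w' e1 : coefficients w = coefficients w' ->
  claim_mgf c w e1 = claim_mgf c w' e1.
Proof. by move=> ww'; rewrite /claim_mgf !(next_stocks_ext _ ww'). Qed.

Lemma tilt_ext w w' : coefficients w = coefficients w' -> tilt w = tilt w'.
Proof. by rewrite /tilt /theta => -[_ _ -> -> _ _]. Qed.

Lemma volatility_ext w w' : coefficients w = coefficients w' ->
  volatility w = volatility w'.
Proof. by rewrite /volatility => -[_ _ _ -> _ _]. Qed.

Lemma log_gap_ext c w w' : coefficients w = coefficients w' ->
  log_gap c w = log_gap c w'.
Proof. by move=> ww'; rewrite /log_gap !(claim_mgf_ext _ _ ww'). Qed.

Lemma log_mean_ext c w w' : coefficients w = coefficients w' ->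
  log_mean c w = log_mean c w'.
Proof. by move=> ww'; rewrite /log_mean !(claim_mgf_ext _ _ ww') (tilt_ext ww'). Qed.

Lemma cost_ext lam g w w' x a : coefficients w = coefficients w' ->
  cost lam g w x a = cost lam g w' x a.
Proof.
move=> ww'; rewrite /cost (log_mean_ext _ ww') (log_gap_ext _ ww').
by rewrite (tilt_ext ww') (volatility_ext ww').
Qed.

Lemma claim_mgf_gt0 c w e1 : 0 < claim_mgf c w e1.
Proof. by rewrite divr_gt0// addr_gt0 ?expR_gt0. Qed.

Lemma claim_mgf0 w e1 : claim_mgf 0 w e1 = 1.
Proof. by rewrite /claim_mgf !mul0r expR0; lra. Qed.

Lemma log_gap0 w : log_gap 0 w = 0.
Proof. by rewrite /log_gap !claim_mgf0 subrr mul0r. Qed.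

Lemma log_mean0 w : log_mean 0 w = 0.
Proof. by rewrite /log_mean !claim_mgf0 ln1 !mulr0 addr0. Qed.

Lemma volatility_neq0 w : volatility w != 0.
Proof.
rewrite mulf_neq0//; first exact: sigma1_neq0 HM _ _ last_period_lt.
by rewrite gt_eqF// sqrtr_gt0 mesh_gt0.
Qed.

Lemma drift_tilt w : mu1 M n w * h = volatility w * tilt w.
Proof.
have s0 : sigma1 M n w != 0 by exact: sigma1_neq0 HM _ _ last_period_lt.
rewrite /volatility /tilt /theta.
rewrite -{1}(sqr_sqrtr (ltW mesh_gt0)).
by field.
Qed.

Lemma tilt_bounds w : 0 <= tilt w <= 1.
Proof.
have /andP[t0 t1] := theta_bounds HM w last_period_lt.
have s0 : 0 < Num.sqrt h by rewrite sqrtr_gt0 mesh_gt0.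
by rewrite /tilt mulr_ge0 ?(ltW s0)//= -ler_pdivlMr// div1r.
Qed.

Lemma stock_return_step e w : increments M n e w ->
  stock_return M n w = mu1 M n w * h + volatility w * (-1) ^+ e.1.
Proof. by case=> e1 _; rewrite /stock_return e1. Qed.

Lemma stocks_step e w : increments M n e w -> stocks M N w = next_stocks w e.
Proof.
move=> Ie; have [e1 e2] := Ie; rewrite /stocks /next_stocks [in LHS]last_periodS.
congr pair.
  rewrite mulrDr mulr1 -(stock_return_step Ie) -(S1_dynamics HM _ last_period_lt).
  by rewrite addrC subrK.
rewrite mulrDr mulr1 -e1 -e2 -(S2_dynamics HM _ last_period_lt).
by rewrite addrC subrK.
Qed.

(** Stated for any event with constant data, not just an atom, so that it also applies to a whole
    state event under a constant strategy. *)
Lemma integral_utility lam g (W a : Omega -> R) A w0 x alpha :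
  Ft M n A -> measurable_wrt (Ft M n) W -> measurable_wrt (Ft M n) a ->
  (forall w, A w -> [/\ W w = x, a w = alpha & coefficients w = coefficients w0]) ->
  (\int[P]_(w in A) (utility M F lam g W a w)%:E =
   (fine (P A) * - cost lam g w0 x alpha)%:E)%E.
Proof.
move=> FA mW ma constA.
have FN := Ft_measurable HM (leqnn N).
have mu : measurable_fun setT (utility M F lam g W a).
  apply: (measurable_wrt_measurable FN).
  by apply: utility_adapted => //; exact: measurable_wrt_cst.
pose c (e : bool * bool) := - (expR (- g * (x + alpha * (mu1 M n w0 * h + volatility w0 * (-1) ^+ e.1)))
                * expR (lam * g * F (next_stocks w0 e))).
rewrite (@integral_step _ _ _ P (Ft M n) (increments M n) (fun=> 2^-1)
  (Ft_measurable HM (ltnW last_period_lt)) _ _ _ A 2^-1 FA _ _ c)//.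
- congr ((_ * _)%:E).
  have := @expcost_tilt _ (tilt w0) (g * alpha * volatility w0) _ _
    (claim_mgf_gt0 (lam * g) w0 false) (claim_mgf_gt0 (lam * g) w0 true).
  rewrite -/(log_mean _ _) -/(log_gap _ _) => cE.
  have -> : cost lam g w0 x alpha = expR (- g * x) * (expR (log_mean (lam * g) w0)
      * expcost (tilt w0) (g * alpha * volatility w0 - log_gap (lam * g) w0)).
    by rewrite /cost expRD mulrA.
  rewrite -cE /c /claim_mgf/= expr0 expr1 drift_tilt.
  rewrite (_ : - g * (x + _) = - g * x + - (g * alpha * volatility w0 * (1 + tilt w0))); last by ring.
  rewrite (_ : - g * (x + _) = - g * x + g * alpha * volatility w0 * (1 - tilt w0)); last by ring.
  by rewrite !expRD; field.
- by move=> e; apply: FN; rewrite [X in Ft M X]last_periodS; exact: increments_adapted.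
- exact: increments_disjoint.
- by move=> e; exact: (b_walk HM _ _ last_period_lt).
- apply: aeW => w Aw e Ie; have [Wx aw cw] := constA w Aw.
  rewrite /utility /terminal_wealth (stocks_step Ie) (stock_return_step Ie) Wx aw.
  rewrite (next_stocks_ext _ cw) /c -expRD (volatility_ext cw).
  have -> : mu1 M n w = mu1 M n w0 by case: cw.
  by congr (- expR _); ring.
Qed.

End LastPeriod.

(** * Equilibrium strategies *)

Section AtomValues.
Context {d : measure_display} {Omega : measurableType d} {R : realType}.
Variables (P : probability Omega R) (G : set (set Omega)).
Hypothesis Gm : G `<=` measurable.

(** A version is constant on an atom, and the atom as test event determines that constant. *)
Lemma cond_exp_on_atom f v A r w : is_cond_exp P G f v -> atom G A ->
  (\int[P]_(w in A) (f w)%:E = (fine (P A) * r)%:E)%E ->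
  (0 < P A)%E -> A w -> v w = r.
Proof.
move=> [_ _ mv /(_ A)] fv atA fr PA Aw; have GA := atA.1.
have mA := Gm GA.
move: (fv GA); rewrite fr.
rewrite (_ : (\int[P]_(w in A) (v w)%:E)%E = (\int[P]_(z in A) cst (v w)%:E z)%E).
  rewrite integral_cst//.
  have PAf : P A \is a fin_num by exact: fin_num_measure.
  have PA0 : 0 < fine (P A) by rewrite -lte_fin fineK.
  have -> : ((v w)%:E * P A = (v w * fine (P A))%:E)%E by rewrite EFinM fineK.
  move=> -[].
  by rewrite mulrC => /mulfI -> //; rewrite gt_eqF.
by apply: eq_integral => z /set_mem Az; rewrite (atom_const mv atA Aw Az).
Qed.

Lemma ae_exists (S : Omega -> Prop) A : {ae P, forall w, S w} ->
  measurable A -> (0 < P A)%E -> exists2 w, A w & S w.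
Proof.
move=> aeS mA PA; apply: contrapT => nS.
suff : P A = 0%E by move=> PA0; rewrite PA0 ltxx in PA.
apply/negligibleP => //; apply: negligibleS aeS => w Aw /= Sw.
by apply: nS; exists w.
Qed.

End AtomValues.

Section Equilibrium.
Context {d : measure_display} {Omega : measurableType d} {R : realType}.
Variables (P : probability Omega R) (M : market R Omega).
Hypothesis HM : is_market M P.
Variables (F : R * R -> R) (mF : measurable_fun setT F).
Variables (gamma : bool -> R) (gamma_gt0 : forall i, 0 < gamma i).
Local Notation N := (steps M).
Local Notation n := (steps M).-1.
Local Notation nN := (ltnW (last_period_lt HM)).
Local Notation risk w := (gamma (J M (steps M).-1 w)).
Local Notation regime_utility lam W a :=
  (fun w => utility M F lam (gamma (J M (steps M).-1 w)) W a w).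

Lemma atom_regime A w w' : atom (Ft M n) A -> A w -> A w' ->
  J M n w = J M n w'.
Proof.
move=> [_ atA] Aw Aw'; apply/esym.
by apply: (atA [set v | J M n v = J M n w] w) => //; exact: J_adapted.
Qed.

Lemma atom_coefficients A w w' : atom (Ft M n) A -> A w -> A w' ->
  coefficients M w = coefficients M w'.
Proof.
move=> atA Aw Aw'.
have cst (f : Omega -> R) : measurable_wrt (Ft M n) f -> f w = f w'.
  by move=> mf; apply/esym; exact: atom_const mf atA Aw Aw'.
have lt := last_period_lt HM.
rewrite /coefficients (cst _ (S1_adapted HM nN)) (cst _ (S2_adapted HM nN)).
rewrite (cst _ (mu1_adapted HM lt)) (cst _ (sigma1_adapted HM lt)).
by rewrite (cst _ (mu2_adapted HM lt)) (cst _ (sigma2_adapted HM lt)).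
Qed.

Lemma regime_utility_adapted lam W a :
  measurable_wrt (Ft M n) W -> measurable_wrt (Ft M n) a ->
  measurable_wrt (Ft M N) (regime_utility lam W a).
Proof.
move=> mW ma.
exact: (utility_adapted HM mF lam (regime_adapted (M := M) gamma (k := n)) mW ma).
Qed.

Lemma utility_on_atom lam W a A w :
  measurable_wrt (Ft M n) W -> measurable_wrt (Ft M n) a ->
  atom (Ft M n) A -> A w ->
  (\int[P]_(w in A) (regime_utility lam W a w)%:E =
   (fine (P A) * - cost M F lam (risk w) w (W w) (a w))%:E)%E.
Proof.
move=> mW ma atA Aw.
rewrite -(@integral_utility _ _ _ _ _ HM _ mF _ _ W a)//.
- by apply: eq_integral => z /set_mem Az; rewrite (atom_regime atA Aw Az).
- exact: atA.1.
- move=> z Az; split; [exact: atom_const mW atA Aw Az|exact: atom_const ma atA Aw Az|].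
  exact: atom_coefficients atA Az Aw.
Qed.

Lemma cond_exp_utility lam W a va A w :
  measurable_wrt (Ft M n) W -> measurable_wrt (Ft M n) a ->
  is_cond_exp P (Ft M n) (regime_utility lam W a) va ->
  atom (Ft M n) A -> (0 < P A)%E -> A w ->
  va w = - cost M F lam (risk w) w (W w) (a w).
Proof.
move=> mW ma cva atA PA Aw.
apply: (cond_exp_on_atom (Ft_measurable HM nN) cva atA _ PA Aw).
exact: utility_on_atom.
Qed.

(** The version is explicit: minus the cost on the atoms and 0 off their union. *)
Lemma cond_exp_utility_exists lam W a :
  measurable_wrt (Ft M n) W -> measurable_wrt (Ft M n) a ->
  exists va, is_cond_exp P (Ft M n) (regime_utility lam W a) va.
Proof.
move=> mW ma; have [T [A [atA nullA]]] := Ft_atomic HM nN.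
pose f w := - cost M F lam (risk w) w (W w) (a w).
have fA t w w' : A t w -> A t w' -> f w = f w'.
  move=> Aw Aw'; rewrite /f (atom_regime (atA t) Aw Aw').
  rewrite (cost_ext _ _ _ _ _ (atom_coefficients (atA t) Aw Aw')).
  by rewrite (atom_const mW (atA t) Aw Aw') (atom_const ma (atA t) Aw Aw').
have mva := const_on_atoms_measurable_wrt atA fA.
set va := (fun w => if _ then _ else _) in mva.
have iu : P.-integrable setT (EFin \o regime_utility lam W a).
  apply: (Ft_integrable HM (b_walk HM) (leqnn N)).
  exact: regime_utility_adapted.
have iva : P.-integrable setT (EFin \o va) := Ft_integrable HM (b_walk HM) nN mva.
exists va; split=> // B FB.
apply: (atoms_eq_integral (Ft_measurable HM nN) atA (nullA _ _ (b_walk HM))) => // t _.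
have [[w Aw]|nA] := pselect (exists w, A t w); last first.
  suff -> : A t = set0 by rewrite !integral_set0.
  by apply/seteqP; split=> // w Aw; apply: nA; exists w.
rewrite (utility_on_atom _ mW ma (atA t) Aw) -/(f w).
have mA : measurable (A t) := Ft_measurable HM nN (atA t).1.
rewrite EFinM fineK ?fin_num_measure// muleC -integral_cst//.
apply: eq_integral => z /set_mem Az; rewrite /va mem_set; last by exists t.
by rewrite (fA t z w).
Qed.

(** The position at which the argument of [expcost] in [cost], already shifted by [log_gap], hits
    the minimiser of [expcost]. *)
Definition strategy lam (w : Omega) : R :=
  (log_gap M F (lam * risk w) w + ln ((1 + tilt M w) / (1 - tilt M w)) / 2)
  / (risk w * volatility M w).

Lemma strategy_ext lam w w' : J M n w = J M n w' ->
  coefficients M w = coefficients M w' -> strategy lam w = strategy lam w'.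
Proof.
move=> Jw cw; rewrite /strategy Jw (log_gap_ext _ _ cw) (tilt_ext cw).
by rewrite (volatility_ext cw).
Qed.

Lemma cost_min lam w x a : 0 < tilt M w < 1 -> a != strategy lam w ->
  cost M F lam (risk w) w x (strategy lam w) < cost M F lam (risk w) w x a.
Proof.
move=> t01 aw; rewrite /cost ltr_pM2l ?expR_gt0//.
have gv : risk w * volatility M w != 0.
  by rewrite mulf_neq0 ?(volatility_neq0 HM) ?(gt_eqF (gamma_gt0 _)).
have E : risk w * strategy lam w * volatility M w =
    log_gap M F (lam * risk w) w + ln ((1 + tilt M w) / (1 - tilt M w)) / 2.
  by rewrite mulrAC mulrC /strategy divfK.
rewrite E [X in expcost _ X < _]addrAC subrr add0r; apply: expcost_min => //.
apply: contra aw => /eqP aE; apply/eqP/(mulfI gv).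
by rewrite [RHS]mulrAC E -aE subrKC mulrAC.
Qed.

(** At tilt 1 the cost has no minimiser; at tilt 0 the drift vanishes and [Hfun] divides by zero. *)
Hypothesis theta_nondegenerate :
  {ae P, forall w, 0 < theta M n w < (Num.sqrt (mesh M))^-1}.

Lemma tilt_nondegenerate A w : atom (Ft M n) A -> (0 < P A)%E -> A w ->
  0 < tilt M w < 1.
Proof.
move=> atA PA Aw.
have [z Az /andP[z0 z1]] := ae_exists theta_nondegenerate (Ft_measurable HM nN atA.1) PA.
rewrite -(tilt_ext (atom_coefficients atA Az Aw)).
have s0 : 0 < Num.sqrt (mesh M) by rewrite sqrtr_gt0 (mesh_gt0 HM).
by rewrite /tilt mulr_gt0//= -ltr_pdivlMr// div1r.
Qed.

(** Competitors are compared atom by atom. The second conclusion speaks of arbitrary atoms because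
    the covering family chosen inside the proof is not visible outside. *)
Lemma equilibrium_strategy lam W : measurable_wrt (Ft M n) W ->
  exists2 alpha, is_equilibrium M gamma F lam P W alpha &
    forall A w, atom (Ft M n) A -> (0 < P A)%E -> A w ->
      alpha w = strategy lam w.
Proof.
move=> mW; have [T [A [atA nullA]]] := Ft_atomic HM nN.
have sA t w w' : A t w -> A t w' -> strategy lam w = strategy lam w'.
  move=> Aw Aw'; apply: strategy_ext; first exact: atom_regime (atA t) Aw Aw'.
  exact: atom_coefficients (atA t) Aw Aw'.
have malpha := const_on_atoms_measurable_wrt atA sA.
set alpha := (fun w => if _ then _ else _) in malpha.
have alphaE t w : A t w -> alpha w = strategy lam w.
  by move=> Aw; rewrite /alpha mem_set//; exists t.
have iW := Ft_integrable HM (b_walk HM) nN mW.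
exists alpha.
  split; first by split.
  have [va cva] := cond_exp_utility_exists lam mW malpha.
  exists va => // b vb [mb _] cvb.
  apply: (ae_atoms (Ft_measurable HM nN) atA (nullA _ _ (b_walk HM))) => t w Aw PA.
  rewrite (cond_exp_utility mW malpha cva (atA t) PA Aw).
  rewrite (cond_exp_utility mW mb cvb (atA t) PA Aw) lerN2 (alphaE _ _ Aw).
  have [->//|bw] := eqVneq (b w) (strategy lam w).
  exact/ltW/cost_min/bw/(tilt_nondegenerate (atA t)).
move=> B w atB PB Bw.
have aeD : {ae P, forall w, (\bigcup_t A t) w}.
  exists (~` \bigcup_t A t); split => //; last exact: nullA (b_walk HM).
  apply: measurableC; apply: fin_bigcup_measurable => [|t _].
    exact: finite_finset.
  by apply: (Ft_measurable HM nN); exact: (atA t).1.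
have [z Bz [t _ Az]] := ae_exists aeD (Ft_measurable HM nN atB.1) PB.
rewrite (atom_const malpha atB Bz Bw) (alphaE t)//.
apply: strategy_ext; first exact: atom_regime atB Bz Bw.
exact: atom_coefficients atB Bz Bw.
Qed.

(** Optimality is tested against the equilibrium already constructed: the minimum is strict, so
    deviating on an atom of positive probability would make that competitor strictly better
    there. *)
Lemma equilibrium_unique lam W alpha : measurable_wrt (Ft M n) W ->
  is_equilibrium M gamma F lam P W alpha ->
  {ae P, forall w, alpha w = strategy lam w}.
Proof.
move=> mW [[malpha _] [va cva optimal]].
have [beta [[mbeta iW] [vb cvb _]] betaE] := equilibrium_strategy lam mW.
have le_ab := optimal beta vb (conj mbeta iW) cvb.
have [T [A [atA nullA]]] := Ft_atomic HM nN.
apply: (ae_atoms (Ft_measurable HM nN) atA (nullA _ _ (b_walk HM))) => t w Aw PA.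
have [z Az] := ae_exists le_ab (Ft_measurable HM nN (atA t).1) PA.
rewrite (cond_exp_utility mW malpha cva (atA t) PA Az).
rewrite (cond_exp_utility mW mbeta cvb (atA t) PA Az) lerN2 (betaE _ _ (atA t) PA Az).
move=> le_z; rewrite (atom_const malpha (atA t) Az Aw).
rewrite -(strategy_ext lam (atom_regime (atA t) Az Aw) (atom_coefficients (atA t) Az Aw)).
apply/eqP; apply: contraTT le_z => az; rewrite -ltNge.
exact: cost_min (tilt_nondegenerate (atA t) PA Az) az.
Qed.

End Equilibrium.

(** * The claim and its indifference price *)

Section ClaimPrice.
Context {d : measure_display} {Omega : measurableType d} {R : realType}.
Variables (P Q : probability Omega R) (M : market R Omega).
Hypothesis HM : is_market M P.
Hypothesis HQ : is_pricing_measure M P Q.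
Variables (F : R * R -> R) (mF : measurable_fun setT F).
Variables (gamma : bool -> R) (gamma_gt0 : forall i, 0 < gamma i) (lam : R).
Variables (K : Type) (U : Omega -> K) (HU : state_variable M U).
Local Notation N := (steps M).
Local Notation n := (steps M).-1.
Local Notation ltnN := (last_period_lt HM).
Local Notation nN := (ltnW (last_period_lt HM)).

Lemma Ft_sigma_algebra k : sigma_algebra setT (Ft M k).
Proof. exact: smallest_sigma_algebra. Qed.

Lemma integral_eq_null (P' : probability Omega R) (f g : Omega -> R) C :
  P'.-integrable setT (EFin \o f) -> P'.-integrable setT (EFin \o g) ->
  measurable C ->
  (\int[P']_(w in C) (f w)%:E = \int[P']_(w in C) (g w)%:E)%E ->
  (forall w, C w -> g w < f w) -> P' C = 0%E.
Proof.
move=> fi gi mC fg ltgf.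
have fiC := integrableS measurableT mC (@subsetT _ C) fi.
have giC := integrableS measurableT mC (@subsetT _ C) gi.
have iB := integrableB mC fiC giC.
have : (\int[P']_(w in C) `|(f w)%:E - (g w)%:E| = 0)%E.
  transitivity (\int[P']_(w in C) ((f w)%:E - (g w)%:E))%E.
    apply: eq_integral => w /set_mem Cw.
    by rewrite gee0_abs// sube_ge0// lee_fin ltW// ltgf.
  by rewrite integralB_EFin// fg subee// (integrable_fin_num mC giC).
move=> /(ae_eq_integral_abs P' mC (measurable_int P' iB)) aeC.
apply/negligibleP => //; apply: negligibleS aeC => w Cw /= /(_ Cw) /eqP.
by rewrite -EFinB /= eqe subr_eq0 gt_eqF// ltgf.
Qed.

(** Lets a trace inclusion on [B] be checked on generators only. *)
Lemma trace_sigma_algebra (G : set (set Omega)) B : sigma_algebra setT G ->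
  sigma_algebra setT [set C | exists2 C', G C' & C `&` B = C' `&` B].
Proof.
move=> [G0 GC GU].
split=> [|A [A' GA' AB]|A HA].
- by exists set0.
- have E X : (setT `\` X) `&` B = B `\` (X `&` B).
    apply/seteqP; split=> w [].
      by move=> [_ nX] Bw; split=> // -[].
    by move=> Bw nX; split=> //; split=> // Xw; exact: nX.
  by exists (setT `\` A'); [exact: GC|rewrite !E AB].
- have /choice[A' HA'] : forall k, exists A', G A' /\ A k `&` B = A' `&` B.
    by move=> k; have [A' ? ?] := HA k; exists A'.
  exists (\bigcup_k A' k); first by apply: GU => k; exact: (HA' k).1.
  rewrite !setI_bigcupl; apply: eq_bigcupr => k _; exact: (HA' k).2.
Qed.

(* Given [E], the stock price at the horizon carries only the last increment
   of [b1] in addition to the information available at the previous date. *)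
Lemma FtS1_with_trace E v C : Ft M n E -> FtS1_with M E C ->
  exists2 C', Ft M n C' &
    C `&` (E `&` [set w | S1 M N w = v]) = C' `&` (E `&` [set w | S1 M N w = v]).
Proof.
move=> FE; set B := E `&` _; have [F0 FC FU] := Ft_sigma_algebra n.
have tr := @trace_sigma_algebra (Ft M n) B (Ft_sigma_algebra n).
move: C; apply: smallest_sub => // A [|->]; last by exists E.
move: A; apply: natural_filtration_sub => // k D kN mD.
rewrite leq_eqVlt [X in (_ < X)%N](last_periodS HM) ltnS in kN.
move: kN => /orP[/eqP->|kn]; last first.
  exists (S1 M k @^-1` D) => //; apply: (Ft_mono kn).
  by apply: (S1_adapted HM) => //; exact: leq_trans kn nN.
(* At the horizon the price equals [v] throughout [B], so a generator traces all of [B] or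
   nothing. *)
have [Dv|nDv] := pselect (D v).
  exists setT; first by rewrite -setC0 -setTD; exact: FC.
  rewrite setTI; apply/seteqP; split=> [w []//|w Bw]; split=> //.
  by case: Bw => _ /= ->.
exists set0 => //; rewrite set0I; apply/seteqP; split=> // w [/= Dw [_ /= Sv]].
by rewrite Sv in Dw.
Qed.

Lemma FtS1_with_sub E : Ft M N E -> FtS1_with M E `<=` Ft M N.
Proof.
move=> FE; apply: smallest_sub; first exact: Ft_sigma_algebra.
move=> A [|->//]; move: A.
apply: natural_filtration_sub => [|k D kN mD]; first exact: Ft_sigma_algebra.
by apply: (Ft_mono kN); apply: (S1_adapted HM kN).
Qed.

Variables (W : Omega -> R) (mW : measurable_wrt (Ft M n) W).

Lemma state_event_adapted V x i s u : measurable_wrt (Ft M n) V ->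
  Ft M n (state_event M U V x i s u).
Proof.
move=> mV.
rewrite (_ : state_event M U V x i s u = V @^-1` [set x] `&`
  [set w | J M n w = i] `&` (S1 M n @^-1` [set s.1]) `&` (S2 M n @^-1` [set s.2])
  `&` [set w | U w = u]); last first.
  case: s => s1 s2; apply/seteqP; split=> w /=.
    by rewrite /stocks => -[Vw Jw [S1w S2w] Uw]; do !split.
  by rewrite /stocks => -[[[[Vw Jw] S1w] S2w] Uw]; split=> //; congr pair.
apply: sigmaI; last exact: HU.1.
apply: sigmaI; last by apply: (S2_adapted HM nN); exact: measurable_set1.
apply: sigmaI; last by apply: (S1_adapted HM nN); exact: measurable_set1.
apply: sigmaI; last exact: J_adapted.
by apply: mV; exact: measurable_set1.
Qed.

Lemma state_event_coefficients V x i s u w w' :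
  state_event M U V x i s u w -> state_event M U V x i s u w' ->
  coefficients M w = coefficients M w'.
Proof.
move=> [_ Jw Sw Uw] [_ Jw' Sw' Uw'].
have [c1 c2 c3 c4] := HU.2 w w' (etrans Jw (esym Jw')) (etrans Sw (esym Sw'))
  (etrans Uw (esym Uw')).
move: Sw; rewrite -Sw' /stocks /coefficients => -[-> ->].
by rewrite c1 c2 c3 c4.
Qed.

Local Notation E := (state_event M U W).

Variable Y : R -> bool -> R * R -> K -> Omega -> R.
Hypothesis HY : is_claim_cond_exp M gamma F lam U Q W Y.

(** * The conditional log-moment of the claim on a state event *)

Section AtState.
Variables (x : R) (i : bool) (s : R * R) (u : K) (w0 : Omega).
Hypothesis Ew0 : E x i s u w0.
Hypothesis QE : (0 < Q (E x i s u))%E.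
Let y := claim_mgf M F (lam * gamma i) w0.
(** The second [false] is a dummy, as the move of b2 does not affect S1. *)
Let v (b : bool) := (next_stocks M w0 (b, false)).1.
Let B b := E x i s u `&` [set w | S1 M N w = v b].

Let FE : Ft M n (E x i s u).
Proof. exact: state_event_adapted. Qed.

(** The current price and the volatility are nonzero, so the two moves of b1 lead to distinct
    prices. *)
Lemma S1_reveals_increment w e b : E x i s u w -> increments M n e w ->
  (S1 M N w = v b) <-> (e.1 = b).
Proof.
move=> Ew Ie; have cw := state_event_coefficients Ew Ew0.
have -> : S1 M N w = v e.1.
  by have := stocks_step HM Ie; rewrite (next_stocks_ext _ cw) => -[->].
split=> [|->//]; rewrite /v/=.
have S0 : S1 M n w0 != 0 by rewrite gt_eqF// (S1_gt0 HM)// nN.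
have V0 := volatility_neq0 HM w0.
by move=> /(mulfI S0)/addrI/addrI/(mulfI V0)/signr_inj.
Qed.

(** On [C] the version integrates like the claim exponential, and the trace lemma writes [C] as an
    event known at t_(N-1) cut by the final price; one-step integration then averages over b2
    only. *)
Lemma claim_cond_exp_integral b C : FtS1_with M (E x i s u) C -> C `<=` B b ->
  (\int[Q]_(w in C) (Y x i s u w)%:E = \int[Q]_(w in C) (y b)%:E)%E.
Proof.
move=> FC CB; have [_ _ _ /(_ C FC) ->] := HY QE.
have [C' FC' C'B] := FtS1_with_trace (v b) FE FC.
have CE : C = C' `&` E x i s u `&` [set w | S1 M N w = v b].
  by rewrite -setIA -[RHS]C'B setIidl.
have FA : Ft M n (C' `&` E x i s u) by exact: sigmaI.
have FN := Ft_measurable HM (leqnn N).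
have mS : measurable [set w | S1 M N w = v b].
  apply: FN; exact: (S1_adapted HM (leqnn N) (measurable_set1 (v b))).
have mC' : measurable (C' `&` E x i s u) := Ft_measurable HM nN FA.
have step (f : Omega -> R) (c : bool * bool -> R) : measurable_fun setT f ->
    (forall e w, E x i s u w -> increments M n e w -> f w = c e) ->
    (\int[Q]_(w in C) (f w)%:E = (fine (Q (C' `&` E x i s u)) *
      (if b then (1 - (1 - tilt M w0) / 2) * (c (true, false) + c (true, true)) / 2
       else (1 - tilt M w0) / 2 * (c (false, false) + c (false, true)) / 2))%:E)%E.
  move=> mf fc; rewrite CE integral_mkcondr epatch_indic /=.
  under eq_integral do rewrite -EFinM.
  (* The indicator of the final price [v b] kills the outcomes with the other b1 move. *)
  pose c' (e : bool * bool) := if e.1 == b then c e else 0.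
  rewrite (@integral_step _ _ _ Q (Ft M n) (increments M n)
    (fun w => (1 - theta M n w * Num.sqrt (mesh M)) / 2)
    (Ft_measurable HM nN) _ _ _ _ ((1 - tilt M w0) / 2) FA _ _ c').
  - by congr (_ * _)%:E; rewrite /c'; case: (b) => /=; lra.
  - move=> e; apply: FN; rewrite [X in Ft M X](last_periodS HM).
    exact: increments_adapted.
  - exact: increments_disjoint.
  - by move=> e; exact: (Q_walk HQ _ _ ltnN).
  - move=> w [_ Ew].
    by have := tilt_ext (state_event_coefficients Ew Ew0); rewrite /tilt => ->.
  - by apply: measurable_funM => //; exact: measurable_indic.
  - apply: aeW => w [_ Ew] e Ie; rewrite (fc e w Ew Ie) /c' indicE.
    have [eb|eb] := eqVneq e.1 b.
      by rewrite mem_set ?mulr1//; apply/(S1_reveals_increment b Ew Ie).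
    rewrite memNset ?mulr0// => /(S1_reveals_increment b Ew Ie) eb'.
    by rewrite eb' eqxx in eb.
rewrite (step _ (fun e => expR (lam * gamma i * F (next_stocks M w0 e)))).
- rewrite (step _ (fun=> y b)); first last.
  + by [].
  + exact: measurable_cst.
  by congr (_ * _)%:E; rewrite /y /claim_mgf; case: (b); lra.
- apply: measurableT_comp => //; apply: measurable_funM => //.
  apply: (measurable_wrt_measurable FN); exact: stocks_fun_adapted HM _ mF.
- move=> e w Ew Ie; rewrite (stocks_step HM Ie).
  by rewrite (next_stocks_ext _ (state_event_coefficients Ew Ew0)).
Qed.

(** The parts of [B b] where [Y] lies below or above [y b] belong to the conditioning sigma-algebra;
    equal integrals over them force both to be null. *)
Lemma claim_cond_exp_value : {ae Q, forall w, E x i s u w ->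
  forall e, increments M n e w -> Y x i s u w = y e.1}.
Proof.
have [_ iY mY _] := HY QE.
have FN := Ft_measurable HM (leqnn N).
have sub := FtS1_with_sub (Ft_mono (leq_pred _) FE).
have FB b : FtS1_with M (E x i s u) (B b).
  apply: sigmaI; first by apply: sub_sigma_algebra; right.
  apply: sub_sigma_algebra; left.
  rewrite (_ : mkset _ = S1 M N @^-1` [set v b])//.
  exact: natural_filtration_preimage.
have icst r : Q.-integrable setT (EFin \o (cst r : Omega -> R)).
  exact: finite_measure_integrable_cst.
have null b D : measurable D ->
    (forall w, D (Y x i s u w) -> Y x i s u w < y b) \/
    (forall w, D (Y x i s u w) -> y b < Y x i s u w) ->
    Q.-negligible (B b `&` Y x i s u @^-1` D).
  move=> mD HD.
  have FC : FtS1_with M (E x i s u) (B b `&` Y x i s u @^-1` D).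
    by apply: sigmaI (FB b) _; exact: (mY _ mD).
  have mC := FN _ (sub _ FC).
  have int := claim_cond_exp_integral FC (@subIsetl _ _ _).
  apply/negligibleP => //; case: HD => HD.
    apply: (integral_eq_null (icst (y b)) iY mC (esym int)) => w [_]; exact: HD.
  by apply: (integral_eq_null iY (icst (y b)) mC int) => w [_]; exact: HD.
have aeb : {ae Q, forall w b, B b w -> Y x i s u w = y b}.
  apply: filter_forall => b.
  have n1 := null b `]-oo, y b[%classic (measurable_itv _) _.
  have n2 := null b `]y b, +oo[%classic (measurable_itv _) _.
  apply: negligibleS (negligibleU (n1 _) (n2 _)).
  - move=> w /= /not_implyP[Bw /eqP]; rewrite neq_lt => /orP[lt|lt].
      by left; split=> //=; rewrite in_itv.
    by right; split=> //=; rewrite in_itv/= lt.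
  - by left=> w /=; rewrite in_itv.
  - by right=> w /=; rewrite in_itv/= andbT.
apply: filterS aeb => w Yw Ew e Ie; apply: Yw; split=> //=.
exact/(S1_reveals_increment e.1 Ew Ie).
Qed.

(** Serves [P] with [q] equal to 1/2 and [Q] with the pricing probability; the identification of [Y]
    is demanded under the measure at hand. *)
Lemma exp_given_log_claim (P' : probability Omega R) p q :
  binomial_walk P' N (Ft M) (b1 M) (b2 M) p ->
  (forall w, E x i s u w -> p n w = q) -> (0 < P' (E x i s u))%E ->
  {ae P', forall w, E x i s u w ->
     forall e, increments M n e w -> Y x i s u w = y e.1} ->
  exp_given P' (E x i s u) (fun w => ln (Y x i s u w)) =
  (q * ln (y false) + (1 - q) * ln (y true))%:E.
Proof.
move=> HP' pq P'E aeY.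
have FN := Ft_measurable HM (leqnn N).
have [_ _ mY _] := HY QE.
have sub := FtS1_with_sub (Ft_mono (leq_pred _) FE).
rewrite /exp_given (@integral_step _ _ _ P' (Ft M n) (increments M n) (p n)
    (Ft_measurable HM nN) _ _ _ _ q FE pq _ (fun e => ln (y e.1))).
- have f0 : fine (P' (E x i s u)) != 0.
    have Pf : P' (E x i s u) \is a fin_num.
      by apply: fin_num_measure; apply: (Ft_measurable HM nN).
    by rewrite gt_eqF// -lte_fin fineK.
  by rewrite -EFinM mulKf//=; congr EFin; lra.
- move=> e; apply: FN; rewrite [X in Ft M X](last_periodS HM).
  exact: increments_adapted.
- exact: increments_disjoint.
- by move=> e; exact: (HP' _ _ _ ltnN).
- apply: measurableT_comp => //.
  by apply: (measurable_wrt_measurable FN); exact: measurable_wrt_sub mY.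
- by apply: filterS aeY => w Yw Ew e Ie; rewrite (Yw Ew e Ie).
Qed.

Lemma exp_given_log_claim_Q :
  exp_given Q (E x i s u) (fun w => ln (Y x i s u w)) =
  (log_mean M F (lam * gamma i) w0)%:E.
Proof.
rewrite (exp_given_log_claim (q := (1 - tilt M w0) / 2) (Q_walk HQ) _ QE claim_cond_exp_value).
  by rewrite /log_mean -/y; congr EFin; lra.
by move=> w Ew; have := tilt_ext (state_event_coefficients Ew Ew0); rewrite /tilt => ->.
Qed.

(** The identification of [Y] holds [Q]-almost surely and is transferred to [P]. Absolute continuity
    covers only events of F_(t_N), so the exceptional set is exhibited as such an event. *)
Lemma exp_given_log_claim_P :
  (forall A, Ft M N A -> Q A = 0%E -> P A = 0%E) -> (0 < P (E x i s u))%E ->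
  exp_given P (E x i s u) (fun w => ln (Y x i s u w)) =
  ((ln (y false) + ln (y true)) / 2)%:E.
Proof.
move=> PQ PE; rewrite (exp_given_log_claim (q := 2^-1) (b_walk HM) _ PE)//.
  by congr EFin; lra.
have FN := Ft_measurable HM (leqnn N).
have [_ _ mY _] := HY QE.
have sub := FtS1_with_sub (Ft_mono (leq_pred _) FE).
suff : {ae P, forall w e, E x i s u w -> increments M n e w -> Y x i s u w = y e.1}.
  by apply: filterS => w + Ew e => /(_ e Ew).
apply: filter_forall => e.
have FI : Ft M N (increments M n e).
  rewrite [X in Ft M X](last_periodS HM); exact: increments_adapted.
set Z := E x i s u `&` increments M n e `&` Y x i s u @^-1` (~` [set y e.1]).
have FZ : Ft M N Z.
  apply: sigmaI.
    apply: sigmaI; first by apply: (Ft_mono (leq_pred _)).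
    exact: FI.
  by apply: sub; exact: (mY _ (measurableC (measurable_set1 (y e.1)))).
exists Z; split; first exact: FN.
- apply: PQ => //; apply/negligibleP; first exact: FN.
  apply: negligibleS claim_cond_exp_value => w [[Ew Ie] Yw] /= H.
  exact/Yw/H.
- by move=> w /= /not_implyP[Ew] /not_implyP[Ie Yw].
Qed.

End AtState.

(** * Value functions and the price at a fixed state *)

Section Value.
Variables (x : R) (i : bool) (s : R * R) (u : K) (w0 : Omega).
Let E0 : set Omega := state_event M U (cst x) x i s u.
Hypothesis Ew0 : E0 w0.

Let FE0 : Ft M n E0.
Proof. by apply: state_event_adapted; exact: measurable_wrt_cst. Qed.

Let mE0 : measurable E0 := Ft_measurable HM nN FE0.

Let utility_integrable mu z a : measurable_wrt (Ft M n) a ->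
  P.-integrable setT (EFin \o utility M F mu (gamma i) (cst z) a).
Proof.
move=> ma; apply: (Ft_integrable HM (b_walk HM) (leqnn N)).
exact: (utility_adapted HM mF mu (@measurable_wrt_cst _ _ _ _ (gamma i))
          (@measurable_wrt_cst _ _ _ _ z) ma).
Qed.

Let utility_on_atom_of mu z a A w : measurable_wrt (Ft M n) a ->
  atom (Ft M n) A -> A `<=` E0 -> A w ->
  (\int[P]_(w in A) (utility M F mu (gamma i) (cst z) a w)%:E =
   (fine (P A) * - cost M F mu (gamma i) w0 z (a w))%:E)%E.
Proof.
move=> ma atA AE Aw; apply: integral_utility => //.
- exact: atA.1.
- exact: measurable_wrt_cst.
- move=> v Av; split=> //; first exact: atom_const ma atA Aw Av.
  exact: state_event_coefficients (AE _ Av) Ew0.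
Qed.

(** D expressed as an amount of wealth. There is no division by the drift, so it also makes sense at
    tilt 0. *)
Definition hedge : R :=
  log_gap M F (lam * gamma i) w0 / (gamma i * volatility M w0).

Definition discount g : R := expR (log_mean M F (lam * gamma i) w0 - gamma i * g).

Lemma cost_shift g a : cost M F lam (gamma i) w0 (x + g) a =
  discount g * cost M F 0 (gamma i) w0 x (a - hedge).
Proof.
rewrite /cost mul0r log_mean0 log_gap0 mulrA -expRD; congr (expR _ * expcost _ _).
  by ring.
rewrite /hedge; field; rewrite (volatility_neq0 HM) gt_eqF//.
Qed.

(** A strategy may vary within the state event, so the pointwise identity for the cost is summed
    over atoms. *)
Lemma utility_shift g a : measurable_wrt (Ft M n) a ->
  (\int[P]_(w in E0) (utility M F lam (gamma i) (cst (x + g)) a w)%:E =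
   (discount g)%:E *
   \int[P]_(w in E0) (utility M F 0 (gamma i) (cst x) (fun w => a w - hedge) w)%:E)%E.
Proof.
move=> ma.
have ma' : measurable_wrt (Ft M n) (fun w => a w - hedge).
  by apply: measurable_wrtB => //; exact: measurable_wrt_cst.
have iu := utility_integrable lam (x + g) ma.
have iu' := utility_integrable 0 x ma'.
rewrite -integralZl//; last exact: integrableS iu'.
under [RHS]eq_integral do rewrite -EFinM.
have [T [A [atA nullA]]] := Ft_atomic HM nN.
apply: (atoms_eq_integral (Ft_measurable HM nN) atA (nullA _ _ (b_walk HM)))
  => //.
  by apply: eq_integrable (integrableZl measurableT (discount g) iu').
move=> t AE; have mA := Ft_measurable HM nN (atA t).1.
have [[w Aw]|nA] := pselect (exists w, A t w); last first.
  suff -> : A t = set0 by rewrite !integral_set0.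
  by apply/seteqP; split=> // w Aw; apply: nA; exists w.
rewrite (utility_on_atom_of _ _ ma (atA t) AE Aw).
under [RHS]eq_integral do rewrite EFinM.
rewrite integralZl//; last exact: integrableS iu'.
rewrite (utility_on_atom_of _ _ ma' (atA t) AE Aw) -EFinM cost_shift.
by congr EFin; ring.
Qed.

(** Subtracting the constant [hedge] permutes the admissible strategies, so both suprema range over
    the same values up to a positive factor. *)
Lemma value_shift g : value M gamma F lam U P (x + g) i s u =
  ((discount g)%:E * value M gamma F 0 U P x i s u)%E.
Proof.
have EE : state_event M U (cst (x + g)) (x + g) i s u = E0.
  by apply/seteqP; split=> w [_ ? ? ?]; split.
have icst z : P.-integrable setT (EFin \o (cst z : Omega -> R)).
  exact: finite_measure_integrable_cst.
have shift (a : Omega -> R) (r : R) : measurable_wrt (Ft M n) a ->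
    measurable_wrt (Ft M n) (fun w => a w + r).
  by move=> ma; apply: measurable_wrtD => //; exact: measurable_wrt_cst.
have E a : measurable_wrt (Ft M n) a ->
    exp_given P E0 (utility M F lam (gamma i) (cst (x + g)) a) =
    ((discount g)%:E *
     exp_given P E0 (utility M F 0 (gamma i) (cst x) (fun w => (a w - hedge)%R)))%E.
  by move=> ma; rewrite /exp_given utility_shift// muleCA.
rewrite /value EE -ereal_sup_pZl ?expR_gt0//; congr ereal_sup.
apply/seteqP; split=> z [].
  move=> a [ma _] <-.
  exists (exp_given P E0 (utility M F 0 (gamma i) (cst x) (fun w => a w - hedge))).
    by exists (fun w => a w - hedge) => //; split=> //; exact: shift.
  exact/esym/E.
move=> _ [a [ma _] <-] <-; exists (fun w => a w + hedge).
  by split=> //; exact: shift.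
apply: etrans (E _ (shift a hedge ma)) _.
suff -> : (fun w => a w + hedge - hedge) = a by [].
by apply/funext => w; rewrite addrK.
Qed.

Hypothesis PE0 : (0 < P E0)%E.

(** Below, the zero strategy; above, the lower bound on [expcost]. Together they make the value a
    nonzero real, so that it can be cancelled from the indifference equation. *)
Lemma value0_bounds :
  ((- expR (- gamma i * x))%:E <= value M gamma F 0 U P x i s u <=
   (- (expR (- gamma i * x) / 2))%:E)%E.
Proof.
have Pf : P E0 \is a fin_num by exact: fin_num_measure.
have P0 : 0 < fine (P E0) by rewrite -lte_fin fineK.
have costE a : cost M F 0 (gamma i) w0 x a =
    expR (- gamma i * x) * expcost (tilt M w0) (gamma i * a * volatility M w0).
  by rewrite /cost mul0r log_mean0 log_gap0 addr0 subr0.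
apply/andP; split.
  apply: ereal_sup_ubound; exists (cst 0).
    split; first exact: measurable_wrt_cst.
    exact: finite_measure_integrable_cst.
  rewrite -/E0 /exp_given (@integral_utility _ _ _ _ _ HM _ mF _ _ _ _ _ w0 x 0)//.
  - rewrite costE mulr0 mul0r expcost0 mulr1 -EFinM mulKf// gt_eqF//.
  - exact: measurable_wrt_cst.
  - exact: measurable_wrt_cst.
  - by move=> w Ew; split=> //; exact: state_event_coefficients Ew Ew0.
apply: ge_ereal_sup => _ [a [ma _] <-]; rewrite -/E0.
set r := - _.
suff : (\int[P]_(w in E0) (utility M F 0 (gamma i) (cst x) a w)%:E
        <= (fine (P E0) * r)%:E)%E.
  move=> le; rewrite /exp_given -[leRHS]mul1e.
  rewrite -(mulVf (lt0r_neq0 P0)) EFinM -muleA.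
  by apply: lee_wpmul2l => //; rewrite lee_fin invr_ge0 ltW.
have intr A : measurable A -> (\int[P]_(w in A) (cst r w)%:E = (fine (P A) * r)%:E)%E.
  move=> mA; rewrite (integral_cst P mA r%:E) EFinM fineK ?fin_num_measure//.
  by rewrite muleC.
rewrite -intr//.
have [T [A [atA nullA]]] := Ft_atomic HM nN.
apply: (atoms_le_integral (Ft_measurable HM nN) atA (nullA _ _ (b_walk HM)))
  => //; first exact: utility_integrable.
  exact: finite_measure_integrable_cst.
move=> t AE; have mA := Ft_measurable HM nN (atA t).1.
have [[w Aw]|nA] := pselect (exists w, A t w); last first.
  suff -> : A t = set0 by rewrite !integral_set0.
  by apply/seteqP; split=> // w Aw; apply: nA; exists w.
rewrite (utility_on_atom_of _ _ ma (atA t) AE Aw) intr// lee_fin.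
apply: ler_wpM2l; first exact: fine_ge0.
rewrite lerN2 costE ler_wpM2l ?expR_ge0//.
by apply: expcost_ge; exact: (tilt_bounds HM w0).
Qed.

Lemma indifference_price_eq g : is_indifference_price M P gamma F lam U x i s u g <->
  g = (gamma i)^-1 * log_mean M F (lam * gamma i) w0.
Proof.
rewrite /is_indifference_price value_shift.
have /andP[lo up] := value0_bounds.
have gi : gamma i != 0 by rewrite gt_eqF.
have [v vE v0] : exists2 v, value M gamma F 0 U P x i s u = v%:E & v != 0.
  have e0 := expR_gt0 (- gamma i * x).
  move: lo up; case: (value _ _ _ _ _ _ _ _ _ _) => [v|//|//].
  rewrite !lee_fin => _ up; exists v => //; rewrite lt_eqF//.
  by rewrite (le_lt_trans up)// oppr_lt0 divr_gt0.
rewrite vE -EFinM; split=> [[]|->].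
  move=> /eqP; rewrite -[eqbRHS]mul1r => /eqP/(mulIf v0).
  by rewrite /discount -expR0 => /expR_inj/eqP; rewrite subr_eq0 => /eqP ->; rewrite mulKf.
by rewrite /discount mulVKf// subrr expR0 mul1r.
Qed.

End Value.

(** The price formula conditions on the actual wealth being [x], the value on wealth reset to [x];
    the first event lies in the second, so a common representative exists and positivity carries
    over. *)
Lemma indifference_price_Gfun x i s u : (0 < P (E x i s u))%E ->
  (0 < Q (E x i s u))%E -> forall g,
  is_indifference_price M P gamma F lam U x i s u g <->
  g = Gfun M gamma U Y Q W x i s u.
Proof.
move=> PE QE g.
have [w0 Ew0] : exists w, E x i s u w.
  apply: contrapT => nE; move: PE.
  rewrite (_ : state_event M U W x i s u = set0) ?measure0 ?ltxx//.
  by apply/seteqP; split=> // w Ew; apply: nE; exists w.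
have sub : E x i s u `<=` state_event M U (cst x) x i s u.
  by move=> w [_ ? ? ?]; split.
rewrite /Gfun (exp_given_log_claim_Q Ew0 QE)/=.
apply: (indifference_price_eq (sub _ Ew0)); apply: (lt_le_trans PE).
apply: le_measure => //; rewrite inE; apply: (Ft_measurable HM nN).
  exact: (state_event_adapted x i s u mW).
exact: (state_event_adapted x i s u (@measurable_wrt_cst _ _ _ _ x)).
Qed.

(** The state event at an outcome contains the whole atom through it. *)
Lemma ae_state_event_gt0 :
  {ae P, forall w, (0 < P (E (W w) (J M n w) (stocks M n w) (U w)))%E}.
Proof.
have [T [A [atA nullA]]] := Ft_atomic HM nN.
apply: (ae_atoms (Ft_measurable HM nN) atA (nullA _ _ (b_walk HM))) => t w Aw PA.
have FE := state_event_adapted (W w) (J M n w) (stocks M n w) (U w) mW.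
apply: (lt_le_trans PA); apply: le_measure; rewrite ?inE.
- by apply: (Ft_measurable HM nN); exact: (atA t).1.
- by apply: (Ft_measurable HM nN); exact: FE.
- by move=> v Av; apply: (atA t).2 FE Aw Av _; split.
Qed.

(** The [P]-mean minus the [Q]-mean of the log-moment is [tilt] times [log_gap]. The denominator of
    [Hfun] is risk aversion times volatility times [tilt], so [tilt] cancels and the shift
    remains. *)
Lemma strategy_Hfun w : 0 < tilt M w ->
  (forall A, Ft M N A -> Q A = 0%E -> P A = 0%E) ->
  (0 < P (E (W w) (J M n w) (stocks M n w) (U w)))%E ->
  (0 < Q (E (W w) (J M n w) (stocks M n w) (U w)))%E ->
  strategy M F gamma lam w = alpha0 M gamma w +
    Hfun M gamma U Y P Q W (W w) (J M n w) (stocks M n w) (U w) w.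
Proof.
move=> t0 PQ PE QE.
have Ew : E (W w) (J M n w) (stocks M n w) (U w) w by [].
rewrite /Hfun (exp_given_log_claim_P Ew QE PQ PE) (exp_given_log_claim_Q Ew QE)/=.
have -> : mesh M * mu1 M n w = volatility M w * tilt M w.
  by rewrite mulrC; exact: drift_tilt HM w.
have -> : alpha0 M gamma w = (2 * gamma (J M n w) * volatility M w)^-1
    * ln ((1 + tilt M w) / (1 - tilt M w)).
  by rewrite /alpha0 /volatility mulrA.
rewrite /strategy /log_gap /log_mean.
have := volatility_neq0 HM w; have := lt0r_neq0 t0.
have := lt0r_neq0 (gamma_gt0 (J M n w)).
move: (volatility M w) (tilt M w) (gamma _) (ln _) (ln _) (ln _) => v t g l l0 l1.
by move=> *; field; do !(apply/andP; split).
Qed.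

Lemma strategy0 w : strategy M F gamma 0 w = alpha0 M gamma w.
Proof.
rewrite /strategy mul0r log_gap0 add0r /alpha0 /tilt /volatility.
by rewrite [RHS]mulrC -!mulrA -!invfM; congr (_ * _); rewrite !mulrA.
Qed.

End ClaimPrice.

Theorem theorem3p1 (R : realType) (d : measure_display)
    (Omega : measurableType d) (P Q : probability Omega R)
    (M : market R Omega) (HM : is_market M P) (HQ : is_pricing_measure M P Q)
    (gamma : bool -> R) (Hgamma : forall i, 0 < gamma i)
    (F : R * R -> R) (HF : measurable_fun setT F)
    (lam : R) (Hlam : 0 <= lam)
    (K : Type) (U : Omega -> K) (HU : state_variable M U)
    (a X : nat -> Omega -> R) (HX : wealth_process M a X)
    (Y : R -> bool -> R * R -> K -> Omega -> R)
    (HY : is_claim_cond_exp M gamma F lam U Q (X (steps M).-1) Y) :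
  let N := steps M in
  let W := X N.-1 in
  let E := state_event M U W in
  let H := Hfun M gamma U Y P Q W in
  let G := Gfun M gamma U Y Q W in
  ({ae P, forall w, 0 < theta M N.-1 w < (Num.sqrt (mesh M))^-1} ->
   (forall A, Ft M N A -> Q A = 0%E -> P A = 0%E) ->
   [/\ exists alpha, is_equilibrium M gamma F 0 P W alpha,
       exists alpha, is_equilibrium M gamma F lam P W alpha &
       forall alphahat0 alphahat,
         is_equilibrium M gamma F 0 P W alphahat0 ->
         is_equilibrium M gamma F lam P W alphahat ->
         {ae P, forall w, alphahat0 w = alpha0 M gamma w} /\
         {ae P, forall w, alphahat w =
            alphahat0 w + H (W w) (J M N.-1 w) (stocks M N.-1 w) (U w) w}])
  /\
  (forall x i s u, (0 < P (E x i s u))%E -> (0 < Q (E x i s u))%E ->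
     forall g, is_indifference_price M P gamma F lam U x i s u g <->
               g = G x i s u)
  /\
  (forall p : Omega -> R,
     {ae P, forall w, is_indifference_price M P gamma F lam U
              (W w) (J M N.-1 w) (stocks M N.-1 w) (U w) (p w)} ->
     {ae P, forall w,
        (0 < Q (E (W w) (J M N.-1 w) (stocks M N.-1 w) (U w)))%E ->
        p w = G (W w) (J M N.-1 w) (stocks M N.-1 w) (U w)}).
Proof.
move=> N W E H G.
have mW : measurable_wrt (Ft M N.-1) W := wealth_adapted HM HX (leqnn _).
have nN : (N.-1 <= N)%N := leq_pred N.
have price := indifference_price_Gfun HM HQ HF Hgamma HU mW HY.
have PE := ae_state_event_gt0 HM HU mW.
split; last split => // p indiff.
  move=> nondeg PQ; split.
  - by have [alpha ?] := equilibrium_strategy HM HF Hgamma nondeg 0 mW; exists alpha.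
  - by have [alpha ?] := equilibrium_strategy HM HF Hgamma nondeg lam mW; exists alpha.
  move=> alphahat0 alphahat eq0 eqlam.
  have ae0 := equilibrium_unique HM HF Hgamma nondeg mW eq0.
  have aelam := equilibrium_unique HM HF Hgamma nondeg mW eqlam.
  split; first by apply: filterS ae0 => w ->; exact: strategy0.
  apply: filterS3 (filterI ae0 aelam) nondeg PE => w [-> ->] /andP[t0 _] PEw.
  rewrite strategy0; apply: (strategy_Hfun HM HQ HF Hgamma HU mW HY) => //.
    by rewrite mulr_gt0// sqrtr_gt0 (mesh_gt0 HM).
  (* Absolute continuity turns positive [P]-probability of the state event into positive
     [Q]-probability. *)
  rewrite lt0e measure_ge0 andbT; apply/negP => /eqP QE0.
  move: PEw; rewrite (PQ _ _ QE0) ?ltxx//.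
  exact: (Ft_mono nN (state_event_adapted HM HU _ _ _ _ mW)).
apply: filterS2 indiff PE => w indiff_w PEw QEw.
exact: (price _ _ _ _ PEw QEw (p w)).1 indiff_w.
Qed.
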